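(* Let $(\theta_n,\mu_n)_{n\ge 0}$ be the joint dual averaging iterates with importance sampling defined in the context. Assume: (a) $f:\Theta\to\mathbb R$ is convex, continuously differentiable, and twice continuously differentiable in a neighborhood of $\theta^\star$; the problem $\min_{\theta\in\Theta} f(\theta)$ has a unique minimizer $\theta^\star$, and $\nabla^2 f(\theta^\star)$ is symmetric positive definite; $\Theta$ is bounded. (b) For every $x\in\mathbb R^r$ the function $\mu\mapsto \ell(x,\mu)$ is logarithmically convex and differentiable. (c) The problem $\min_{\mu\in\mathcal M} v(\theta^\star,\mu)$ has a unique minimizer $\mu^\star$, and $\nabla^2_\mu v(\theta^\star,\mu^\star)$ is symmetric positive definite; $\mathcal M$ is bounded; there are constants $G_M,H_M<\infty$ such that for all $\theta\in\Theta$, $\mu\in\mathcal M$: $\mathbb E_{X\sim\mathbb P}[\|G(\theta,X)\|^2\ell(X,\mu)]\le G_M^2$ and $\mathbb E_{X\sim\mathbb P}[\|P_{A_a^\theta}G(\theta,X)\|^4\|\nabla_\mu\ell(X,\mu)\|^2]\le H_M^2$. (d) There is $c_1>0$ such that for all $\theta\in\Theta$, $\mu\in\mathcal M$: $f(\theta)-f(\theta^\star)\ge c_1\|\theta-\theta^\star\|^2$ and $v(\theta^\star,\mu)-v(\theta^\star,\mu^\star)\ge c_1\|\mu-\mu^\star\|^2$. There are $c_2,c_3<\infty$ such that for all $\theta\in\Theta$, $\mu\in\mathcal M$: $\|\nabla f(\theta)-\nabla f(\theta^\star)\|\le c_2\|\theta-\theta^\star\|$ and $\|\nabla_\mu v(\theta^\star,\mu)-\nabla_\mu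 v(\theta^\star,\mu^\star)\|\le c_2\|\mu-\mu^\star\|$; and $\|\nabla_\mu v(\theta,\mu)-\nabla_\mu v(\theta^\star,\mu)\|\le c_3\|\theta-\theta^\star\|^2$ for all $\mu\in\mathcal M$ and all $\theta\in\Theta$ with $A_a^\star\theta=b_a^\star$, $A_i^\star\theta<b_i^\star$. Moreover $-\nabla f(\theta^\star)=A_a^{\star\top}\lambda$ for some $\lambda\in\mathbb R^{p_1}_{++}$. Then $(\theta_n,\mu_n)\to(\theta^\star,\mu^\star)$ almost surely as $n\to\infty$.
   Context: Notation: $\|\cdot\|$ is the Euclidean norm; $\mathbb R_{++}=\{x\in\mathbb R:x>0\}$; $B^\dagger$ is the Moore–Penrose pseudoinverse of $B$; vector inequalities are componentwise. Setup. $\Theta=\{\theta\in\mathbb R^s: A\theta\le b\}$ with $A\in\mathbb R^{p\times s}$, $b\in\mathbb R^p$, and $\mathcal M=\{\mu\in\mathbb R^m: C\mu\le d\}$ for a matrix $C$ and vector $d$. $\mathbb P$ is a probability distribution on $\mathcal X\subseteq\mathbb R^r$, $F:\mathbb R^s\times\mathbb R^r\to\mathbb R$, $f(\theta)=\mathbb E_{X\sim\mathbb P}[F(\theta,X)]$, $G(\theta,x)=\nabla_\theta F(\theta,x)$, and $\nabla f(\theta)=\mathbb E_{X\sim\mathbb P}[G(\theta,X)]$. $(\mathbb P_\mu)_{\mu\in\mathcal M}$ is a family of probability distributions with $\mathbb P\ll\mathbb P_\mu$ (the importance sampling family), with likelihood ratio $\ell(x,\mu)=\frac{d\mathbb P}{d\mathbb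 P_\mu}(x)$; put $G_\mu(\theta,x)=\ell(x,\mu)G(\theta,x)$. Active constraints. For $\theta\in\Theta$, $A_a^\theta,b_a^\theta$ (resp. $A_i^\theta,b_i^\theta$) collect the rows of $A$, entries of $b$ of the constraints that are active, $A_a^\theta\theta=b_a^\theta$ (resp. inactive, $A_i^\theta\theta<b_i^\theta$). For $\theta=\theta^\star$ write $A_a^\star,b_a^\star,A_i^\star,b_i^\star$; $p_1$ is the dimension of $b_a^\star$. For a matrix $B$, $P_B=I-B^\top(BB^\top)^\dagger B$ is the orthogonal projector onto $\mathrm{Ker}(B)$ (and $P_B=I$ if $B$ has no rows). Importance sampling objective. $v(\theta,\mu)=\mathbb E_{X\sim\mathbb P}[\|P_{A_a^\theta}G(\theta,X)\|^2\ell(X,\mu)]$ and $H(\theta,\mu,x)=\|P_{A_a^\theta}G(\theta,x)\|^2\nabla_\mu\ell(x,\mu)$. Algorithm. Let $\alpha_n=\alpha/n^\gamma$ ($n\ge1$) with $\alpha>0$, $\gamma\in(1/2,1)$, and let $(\theta_0,\mu_0)\in\Theta\times\mathcal M$ be deterministic. For $n\ge0$, $$(\theta_{n+1},\mu_{n+1})=\arg\min_{(\theta,\mu)\in\Theta\times\mathcal M}\Big\{\sum_{k=0}^n\alpha_{k+1}\big(\langle G_k,\theta\rangle+\langle H_k,\mu\rangle\big)+\tfrac12\|\theta-\theta_0\|^2+\tfrac12\|\mu-\mu_0\|^2\Big\},$$ where $G_k=G_{\mu_k}(\theta_k,X_{k+1}^{(\mu_k)})$, $H_k=H(\theta_k,\mu_k,X_{k+1})$,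 $\mathcal F_n=\sigma(X_k^{(\mu_{k-1})},X_k: k\le n)$, and, conditionally on $\mathcal F_k$, $X_{k+1}^{(\mu_k)}\sim\mathbb P_{\mu_k}$ and $X_{k+1}\sim\mathbb P$ are independent. *)

(* Defs.v *)
From HB Require Import structures.
From mathcomp Require Import all_boot all_order all_algebra.
From mathcomp Require Import all_classical all_reals all_analysis measurable_realfun.

Set Implicit Arguments.
Unset Strict Implicit.
Unset Printing Implicit Defensive.

Import Order.TTheory GRing.Theory Num.Theory.
Import numFieldNormedType.Exports.

Local Open Scope classical_set_scope.
Local Open Scope ring_scope.

(* Matrices, in particular R^n = 'cV[R]_n, carry their Borel sigma-algebra. *)
HB.instance Definition _ (R : realType) (m n : nat) :=
  Measurable.copy 'M[R]_(m, n) (g_sigma_algebraType (@open 'M[R]_(m, n))).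

Section Euclidean.
Context {R : realType}.

Definition dotv n (u v : 'cV[R]_n) : R := \sum_i u i 0 * v i 0.

(* The library's norm on matrices is the sup norm. *)
Definition enorm n (u : 'cV[R]_n) : R := Num.sqrt (dotv u u).

Definition posdef n (M : 'M[R]_n) : Prop :=
  M^T = M /\ forall u : 'cV[R]_n, u != 0 -> 0 < dotv u (M *m u).

Definition gradient n (f : 'cV[R]_n -> R) (a : 'cV[R]_n) : 'cV[R]_n :=
  \col_i 'D_(delta_mx i 0) (f : 'cV[R]_n -> R^o) a.

Definition hessian n (f : 'cV[R]_n -> R) (a : 'cV[R]_n) : 'M[R]_n :=
  \matrix_(i, j) (gradient (fun x => gradient f x j 0) a) i 0.

Definition differentiable_at n (f : 'cV[R]_n -> R) (a : 'cV[R]_n) : Prop :=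
  differentiable (f : 'cV[R]_n -> R^o) a.

Definition C1_on n (D : set 'cV[R]_n) (f : 'cV[R]_n -> R) : Prop :=
  (forall x, D x -> differentiable_at f x) /\
  {within D, continuous (gradient f)}.

Definition twice_differentiable_at n (f : 'cV[R]_n -> R) (a : 'cV[R]_n) : Prop :=
  (\forall x \near a, differentiable_at f x) /\ differentiable (gradient f) a.

Definition C2_near n (f : 'cV[R]_n -> R) (a : 'cV[R]_n) : Prop :=
  \forall x \near a,
    twice_differentiable_at f x /\ {for x, continuous (hessian f)}.

Definition argmin T (D : set T) (f : T -> R) : set T :=
  [set x | D x /\ forall y, D y -> f x <= f y].

Definition unique_argmin T (D : set T) (f : T -> R) (x : T) : Prop :=
  argmin D f = [set x].

(* Convexity of log h, with log 0 = -oo; no +oo can occur on the right. *)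
Definition log_convex n (D : set 'cV[R]_n) (h : 'cV[R]_n -> R) : Prop :=
  (forall x, D x -> 0 <= h x) /\
  forall (x y : 'cV[R]_n) (t : R), D x -> D y -> 0 < t < 1 ->
    (lne (h (t *: x + (1 - t) *: y))%:E <=
     t%:E * lne (h x)%:E + (1 - t)%:E * lne (h y)%:E)%E.

End Euclidean.

Section Polyhedra.
Context {R : realType}.

Definition polyhedron p n (A : 'M[R]_(p, n)) (b : 'cV[R]_p) : set 'cV[R]_n :=
  [set x | forall i, (A *m x) i 0 <= b i 0].

Definition active p n (A : 'M[R]_(p, n)) (b : 'cV[R]_p) (x : 'cV[R]_n) :
  {set 'I_p} := [set i | (A *m x) i 0 == b i 0]%SET.

Definition inactive p n (A : 'M[R]_(p, n)) (b : 'cV[R]_p) (x : 'cV[R]_n) :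
  {set 'I_p} := [set i | (A *m x) i 0 < b i 0]%SET.

Definition rows_of p n (I : {set 'I_p}) (B : 'M[R]_(p, n)) : 'M[R]_(#|I|, n) :=
  rowsub (fun k : 'I_#|I| => enum_val k) B.

Definition active_face p n (A : 'M[R]_(p, n)) (b : 'cV[R]_p) (x0 : 'cV[R]_n) :
    set 'cV[R]_n :=
  [set x | rows_of (active A b x0) A *m x = rows_of (active A b x0) b /\
    forall i, (rows_of (inactive A b x0) A *m x) i 0 <
              rows_of (inactive A b x0) b i 0].

Definition is_pseudoinverse p n (B : 'M[R]_(p, n)) (X : 'M[R]_(n, p)) : Prop :=
  [/\ B *m X *m B = B, X *m B *m X = X,
      (B *m X)^T = B *m X & (X *m B)^T = X *m B].

Lemma is_pseudoinverse_uniq p n (B : 'M[R]_(p, n)) (X Y : 'M[R]_(n, p)) :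
  is_pseudoinverse B X -> is_pseudoinverse B Y -> X = Y.
Proof.
case=> X1 X2 X3 X4 [Y1 Y2 Y3 Y4].
have BXY : B *m X = B *m Y.
  by rewrite -X3 -{1}Y1 -mulmxA trmx_mul X3 Y3 mulmxA X1.
have XBY : X *m B = Y *m B.
  have -> : X *m B = (X *m B) *m (Y *m B) by rewrite -mulmxA (mulmxA B) Y1.
  by rewrite -X4 -Y4 -trmx_mul -mulmxA (mulmxA B) X1.
by rewrite -X2 XBY -mulmxA BXY mulmxA Y2.
Qed.

Lemma is_pseudoinverse_ex p n (B : 'M[R]_(p, n)) : exists X, is_pseudoinverse B X.
Proof.
have gramE k l (F : 'M[R]_(k, l)) : row_free F -> F *m F^T \in unitmx.
  move=> Ffree; rewrite -row_free_unit -kermx_eq0; apply/eqP/row_matrixP => i.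
  rewrite row0; set u := row i _.
  have uF : u *m (F *m F^T) = 0 by apply: sub_kermxP; exact: row_sub.
  have w0 : (u *m F) *m (u *m F)^T = 0.
    by rewrite trmx_mul !mulmxA -(mulmxA u) uF mul0mx.
  apply: (row_free_inj Ffree); rewrite mul0mx; apply/rowP => j.
  have /eqP : (u *m F *m (u *m F)^T) 0 0 = 0 by rewrite w0 mxE.
  rewrite mxE psumr_eq0; last by move=> k' _; rewrite [X in _ * X]mxE -expr2 sqr_ge0.
  move/allP/(_ j (mem_index_enum _)) => /=.
  by rewrite [X in _ * X]mxE -expr2 sqrf_eq0 [in RHS]mxE => /eqP.
have := mulmx_base B; have := row_base_free B; have := col_base_full B.
move: (col_base B) (row_base B); move: (\rank B) => k C F Cfull Ffree /esym BE.
have FU : F *m F^T \in unitmx by exact: gramE.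
have CU : C^T *m C \in unitmx.
  by rewrite -{2}[C]trmxK; apply: gramE; rewrite /row_free mxrank_tr.
pose X := F^T *m invmx (F *m F^T) *m (invmx (C^T *m C) *m C^T).
have FFK l (Z : 'M[R]_(k, l)) : F *m (F^T *m (invmx (F *m F^T) *m Z)) = Z.
  by rewrite !mulmxA mulmxV // mul1mx.
have CCK l (Z : 'M[R]_(k, l)) : invmx (C^T *m C) *m (C^T *m (C *m Z)) = Z.
  by rewrite (mulmxA C^T) mulKmx.
have BX : B *m X = C *m invmx (C^T *m C) *m C^T.
  by rewrite BE /X -!mulmxA FFK.
have XB : X *m B = F^T *m invmx (F *m F^T) *m F.
  by rewrite BE /X -!mulmxA CCK.
exists X; split.
- by rewrite BX BE -!mulmxA CCK.
- by rewrite XB /X -!mulmxA FFK.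
- by rewrite BX !trmx_mul trmxK trmx_inv trmx_mul trmxK mulmxA.
- by rewrite XB !trmx_mul trmxK trmx_inv trmx_mul trmxK mulmxA.
Qed.

Definition pseudoinverse p n (B : 'M[R]_(p, n)) : 'M[R]_(n, p) :=
  xget 0 [set X | is_pseudoinverse B X].

Lemma pseudoinverseP p n (B : 'M[R]_(p, n)) :
  is_pseudoinverse B (pseudoinverse B).
Proof. exact: xgetPex (is_pseudoinverse_ex B). Qed.

Definition proj_ker p n (B : 'M[R]_(p, n)) : 'M[R]_n :=
  1%:M - B^T *m pseudoinverse (B *m B^T) *m B.

End Polyhedra.

Section Conditioning.
Context {R : realType} {d : measure_display} {Omega : measurableType d}.
Context {d' : measure_display} {T : measurableType d'}.
Variable Pr : probability Omega R.

(* Sigma-algebra generated by the Y_k and X_k, 1 <= k <= n; trivial if n = 0. *)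
Definition history (Y X : nat -> Omega -> T) (n : nat) : set (set Omega) :=
  <<s [set E | exists (k : nat) (B : set T), [/\ (1 <= k <= n)%N, measurable B &
         E = Y k @^-1` B \/ E = X k @^-1` B]] >>.

Definition is_cond_prob (Fn : set (set Omega)) (E : set Omega)
    (q : Omega -> \bar R) : Prop :=
  (forall U : set (\bar R), measurable U -> Fn (q @^-1` U)) /\
  forall A, Fn A -> (\int[Pr]_(w in A) q w)%E = Pr (A `&` E).

Definition is_cond_law (Fn : set (set Omega)) (Z : Omega -> T)
    (K : Omega -> probability T R) : Prop :=
  forall B, measurable B -> is_cond_prob Fn (Z @^-1` B) (fun w => K w B).

Definition cond_indep_laws (Fn : set (set Omega))
    (Z : Omega -> T) (K : Omega -> probability T R)
    (Z' : Omega -> T) (K' : Omega -> probability T R) : Prop :=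
  [/\ is_cond_law Fn Z K, is_cond_law Fn Z' K' &
      forall B B', measurable B -> measurable B' ->
        is_cond_prob Fn (Z @^-1` B `&` Z' @^-1` B')
          (fun w => K w B * K' w B')%E].

End Conditioning.

Section Objectives.
Context {R : realType} {s m r p : nat}.
Variables (A : 'M[R]_(p, s)) (b : 'cV[R]_p).
Variable P : probability 'cV[R]_r R.
Variables (F : 'cV[R]_s -> 'cV[R]_r -> R) (ell : 'cV[R]_r -> 'cV[R]_m -> R).

Definition objective (theta : 'cV[R]_s) : R := \int[P]_x F theta x.

Definition Ggrad (theta : 'cV[R]_s) (x : 'cV[R]_r) : 'cV[R]_s :=
  gradient (fun t => F t x) theta.

Definition G_is (mu : 'cV[R]_m) (theta : 'cV[R]_s) (x : 'cV[R]_r) : 'cV[R]_s :=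
  ell x mu *: Ggrad theta x.

Definition proj_grad (theta : 'cV[R]_s) (x : 'cV[R]_r) : 'cV[R]_s :=
  proj_ker (rows_of (active A b theta) A) *m Ggrad theta x.

Definition v_is (theta : 'cV[R]_s) (mu : 'cV[R]_m) : R :=
  \int[P]_x (enorm (proj_grad theta x) ^+ 2 * ell x mu).

Definition H_is (theta : 'cV[R]_s) (mu : 'cV[R]_m) (x : 'cV[R]_r) : 'cV[R]_m :=
  enorm (proj_grad theta x) ^+ 2 *: gradient (ell x) mu.

End Objectives.

Section DualAveraging.
Context {R : realType} {s m : nat}.

Definition step (alpha gamma : R) (n : nat) : R := alpha / (n%:R `^ gamma).

Definition dual_averaging_objective (alpha gamma : R)
    (theta0 : 'cV[R]_s) (mu0 : 'cV[R]_m)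
    (g : nat -> 'cV[R]_s) (h : nat -> 'cV[R]_m) (n : nat)
    (z : 'cV[R]_s * 'cV[R]_m) : R :=
  \sum_(k < n.+1) step alpha gamma k.+1 * (dotv (g k) z.1 + dotv (h k) z.2)
  + 2^-1 * enorm (z.1 - theta0) ^+ 2 + 2^-1 * enorm (z.2 - mu0) ^+ 2.

End DualAveraging.

(* Main.v *)
(** Both blocks of the algorithm are lazy mirror descent: with
    [y_n = x_0 - sum_(k<n) a_k g_k], the iterate [x_n] is the projection of
    [y_n] on a polyhedron. The energy [(|y_n - x*|^2 - |y_n - x_n|^2) / 2]
    decreases up to summable terms, so it converges and
    [sum a_n |x_n - x*|^2 < oo]; hence [x_n] comes back arbitrarily close to
    [x*], where (on a polyhedron) the energy is just [|x_n - x*|^2 / 2], and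
    its limit must be 0. The summable terms are martingale increments with
    bounded second moments, whose weighted sums converge a.s. by Kolmogorov's
    stopping argument.

    For [theta] the drift is the gradient inequality for the convex [f]. Since
    [- y_n / sum_(k<n) a_k] tends to the gradient of [f] at [theta*], strict
    complementarity forces [theta_n] onto the active face after finitely many
    steps. From then on the drift of [mu] differs from the one of
    [v(theta*, .)] by [O(|theta_n - theta*|^2)], which is summable against
    [a_n], and the same argument applies. *)
Require Import Defs.
From HB Require Import structures.
From mathcomp Require Import all_boot all_order all_algebra.
From mathcomp Require Import all_classical all_reals all_analysis measurable_realfun.
From mathcomp Require Import ring lra.

Set Implicit Arguments.
Unset Strict Implicit.
Unset Printing Implicit Defensive.

Import Order.TTheory GRing.Theory Num.Theory.
Import numFieldNormedType.Exports.

Local Open Scope classical_set_scope.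
Local Open Scope charge_scope.
Local Open Scope ring_scope.

(** The distance to [x*] is not itself a Lyapunov function: a lazy projection remembers [y_n], whose
    normal component may keep growing along the active constraints. The energy charges for that
    component.

    The [mu] block cannot be treated on its own: the projector in [H] depends on [theta] through the
    set of active constraints, hence discontinuously, and [v(theta, .)] is compared with
    [v(theta*, .)] only on the active face of [theta*]. So the face must be reached in finite time,
    and the summability of [a_n |theta_n - theta*|^2] must be carried along with the convergence.

    Probability enters through two almost sure statements, applied to finitely many predictable test
    directions: [x_n - x*] gives the noise of the energy, the basis vectors give the noise of each
    coordinate and, through squares, the sum of [a_n^2 |g_n|^2]. Outside a null set the rest is
    deterministic. A conditional law is treated as a kernel on [Omega] with the coarser
    sigma-algebra, so a conditional mean is an integral against that kernel with the past frozen. *)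

(** * Conditional laws as kernels *)

Section Disintegration.
Context {R : realType} {d d1 d2 : measure_display}.
Context {Omega : measurableType d} {S : measurableType d1} {T : measurableType d2}.
Variable Pr : probability Omega R.
Variables (W : Omega -> S) (Z : Omega -> T).
Hypotheses (mW : measurable_fun setT W) (mZ : measurable_fun setT Z).
Variable K : S -> probability T R.
Hypothesis mK : forall B, measurable B -> measurable_fun setT (fun s => K s B).
Hypothesis KE : forall A B, measurable A -> measurable B ->
  (\int[Pr]_(w in W @^-1` A) K (W w) B = Pr (W @^-1` A `&` Z @^-1` B))%E.

Let mWZ : measurable_fun setT (fun w => (W w, Z w)).
Proof. exact: measurable_fun_pair. Qed.

(* The measurability proof is a phantom argument, needed by the instances below. *)
Definition prob_kernel_of of
  (forall B, measurable B -> measurable_fun setT (fun s => K s B)) :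
  S -> {measure set T -> \bar R} := K.

HB.instance Definition _ := isKernel.Build _ _ S T R (prob_kernel_of mK) mK.

Let prob_kernel_of1 s : prob_kernel_of mK s setT = 1%E.
Proof. exact: probability_setT. Qed.

HB.instance Definition _ :=
  Kernel_isProbability.Build _ _ S T R (prob_kernel_of mK) prob_kernel_of1.

Let mslice (s : S) : measurable_fun setT (fun x : T => (s, x)).
Proof. exact: measurable_fun_pair. Qed.

(** The product of the Dirac mass at [s.2] with [K s.2]. The dummy [unit] factor is the source of
    the constant kernel [W_law] with which it is composed. *)
Definition slice_law (s : unit * S) : {measure set (S * T) -> \bar R} :=
  measure_function_pushforward__canonical__measure_function_Measure
    (K s.2) (mslice s.2).

Let measurable_slice_law U : measurable U -> measurable_fun setT (slice_law ^~ U).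
Proof.
move=> mU.
have := measurable_fun_xsection_finite_kernel (prob_kernel_of mK) (mem_set mU).
move=> h; have : measurable_fun setT ((fun s => K s (xsection U s)) \o (@snd unit S)).
  exact: measurableT_comp.
congr (measurable_fun _ _); apply/funext => -[[] s] /=.
by rewrite /pushforward /= xsectionE.
Qed.

HB.instance Definition _ := isKernel.Build _ _ _ _ R slice_law measurable_slice_law.

Let slice_law1 s : slice_law s setT = 1%E.
Proof. by rewrite /slice_law /= /pushforward preimage_setT probability_setT. Qed.

HB.instance Definition _ :=
  Kernel_isProbability.Build _ _ _ _ R slice_law slice_law1.

Definition W_law (_ : unit) : {measure set S -> \bar R} :=
  measure_function_pushforward__canonical__measure_function_Measure Pr mW.

Let measurable_W_law U : measurable U -> measurable_fun setT (W_law ^~ U).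
Proof. by move=> mU; exact: measurable_cst. Qed.

HB.instance Definition _ := isKernel.Build _ _ _ _ R W_law measurable_W_law.

Let W_law1 s : W_law s setT = 1%E.
Proof. by rewrite /W_law /= /pushforward preimage_setT probability_setT. Qed.

HB.instance Definition _ :=
  Kernel_isProbability.Build _ _ _ _ R W_law W_law1.

Let WZ_law : {measure set (S * T) -> \bar R} :=
  measure_function_pushforward__canonical__measure_function_Measure Pr mWZ.

(** Both sides are finite measures that agree on rectangles by [KE], and rectangles form a pi-system
    generating the product sigma-algebra. *)
Let joint_lawE U : measurable U -> WZ_law U = mkcomp W_law slice_law tt U.
Proof.
apply: (measure_unique [set A `*` B | A in measurable & B in measurable]
                       (fun=> setT)).
- by rewrite measurable_prod_measurableType.
- move=> _ _ [A mA [B mB <-]] [A' mA' [B' mB' <-]]; rewrite -setXI.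
  by exists (A `&` A'); [exact: measurableI|exists (B `&` B') => //; exact: measurableI].
- by move=> _; exists setT => //; exists setT => //; rewrite setXTT.
- by rewrite bigcup_const.
- move=> _ [A mA [B mB <-]].
  rewrite /= /pushforward /kcomp /W_law /=.
  transitivity (Pr (W @^-1` A `&` Z @^-1` B)) => //.
  have mk : measurable_fun setT (fun y : S => slice_law (tt, y) (A `*` B)).
    apply: (measurableT_comp (f := slice_law ^~ (A `*` B)) (g := pair tt)).
      by apply: measurable_slice_law; exact: measurableX.
    exact: measurable_fun_pair.
  rewrite -KE// ge0_integral_pushforward//=.
  rewrite preimage_setT /= integral_mkcond; apply: eq_integral => w _ /=.
  rewrite /slice_law /pushforward patchE; case: ifPn => wA.
    congr (K _ _); apply/seteqP; split => x /=; last by case.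
    by split => //; move: wA; rewrite inE.
  rewrite [X in K _ X](_ : _ = set0) ?measure0//.
  by apply/seteqP; split => x //= [Aw _]; move: wA; rewrite notin_setE.
  by move=> s _; exact: (measure_ge0 (slice_law (tt, s))).
- move=> k; apply: (@le_lt_trans _ _ 1%E); last by rewrite ltey.
  by rewrite /= /pushforward preimage_setT probability_setT.
Qed.

Lemma disintegration (f : S * T -> \bar R) :
  (forall z, (0 <= f z)%E) -> measurable_fun setT f ->
  (\int[Pr]_w f (W w, Z w) = \int[Pr]_w \int[K (W w)]_x f (W w, x))%E.
Proof.
move=> f0 mf.
transitivity (\int[WZ_law]_z f z)%E.
  by rewrite ge0_integral_pushforward//.
transitivity (\int[mkcomp W_law slice_law tt]_z f z)%E.
  by apply: eq_measure_integral => U mU _; exact: joint_lawE.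
rewrite [LHS]integral_kcomp// /W_law /=.
under eq_integral => s _ do rewrite ge0_integral_pushforward//=.
rewrite ge0_integral_pushforward//=; last first.
- by move=> s _; exact: integral_ge0.
exact: (measurable_fun_integral_finite_kernel f (prob_kernel_of mK)).
Qed.

End Disintegration.

Lemma measurable_fun_coarser {d d2} {Omega : measurableType d}
    {T : measurableType d2} (G : set (set Omega)) (f : Omega -> T) :
  (forall E, <<s G >> E -> measurable E) ->
  @measurable_fun _ _ (g_sigma_algebraType G) T setT f ->
  measurable_fun setT f.
Proof.
move=> GE mf _ U mU; rewrite setTI; apply: GE.
by have := mf measurableT U mU; rewrite setTI.
Qed.

(** * Second moments, Cauchy tails and stopped sums *)

Section CenteredMoment.
Context {R : realType} {d} {T : measurableType d}.
Variables (P : probability T R) (g : T -> R) (V : R).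
Hypothesis mg : measurable_fun setT g.
Hypothesis g2V : (\int[P]_x (g x ^+ 2)%:E <= V%:E)%E.

Lemma integrable_sqr : P.-integrable setT (fun x => (g x ^+ 2)%:E).
Proof.
apply/integrableP; split.
  by apply/measurable_EFinP; exact: measurable_funX.
under eq_integral => x _ do rewrite gee0_abs ?lee_fin ?sqr_ge0//.
exact: le_lt_trans g2V (ltry _).
Qed.

Lemma integrable_of_sqr : P.-integrable setT (EFin \o g).
Proof.
apply: (@le_integrable _ _ _ P setT measurableT _
          (fun x => (1 + g x ^+ 2)%:E)).
- exact/measurable_EFinP.
- move=> x _ /=; rewrite lee_fin [leRHS]ger0_norm; last first.
    by rewrite addr_ge0 ?sqr_ge0.
  have := sqr_ge0 (`|g x| - 1); rewrite -[g x ^+ 2]real_normK ?num_real//.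
  have := normr_ge0 (g x); nra.
- apply: (eq_integrable measurableT (fun x => cst 1%:E x + (g x ^+ 2)%:E)%E) => //.
  apply: integrableD => //; last exact: integrable_sqr.
  by apply/integrableP; split => //; rewrite integral_cst//= normr1 mul1e
    probability_setT ltry.
Qed.

(** The cross term has mean zero and the variance of [g] is at most its second moment. *)
Lemma centered_moment_le (c a : R) :
  (\int[P]_x ((c + a * (g x - \int[P]_x g x)) ^+ 2)%:E <= (c ^+ 2 + a ^+ 2 * V)%:E)%E.
Proof.
pose mn := \int[P]_x g x; rewrite -/mn.
have ig := integrable_of_sqr; have i2 := integrable_sqr.
have mnE : (\int[P]_x (g x)%:E = mn%:E)%E.
  by rewrite /mn /Rintegral fineK//; exact: integrable_fin_num.
pose c0 := c - a * mn.
under eq_integral => x _.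
  rewrite (_ : _%:E = (c0 ^+ 2)%:E + ((2 * c0 * a)%:E * (g x)%:E +
                       (a ^+ 2)%:E * (g x ^+ 2)%:E))%E; last first.
    by rewrite -!EFinM -!EFinD; congr EFin; rewrite /c0; ring.
  over.
have i1 : P.-integrable setT (fun x => (2 * c0 * a)%:E * (g x)%:E)%E.
  exact: integrableZl.
have i3 : P.-integrable setT (fun x => (a ^+ 2)%:E * (g x ^+ 2)%:E)%E.
  exact: integrableZl.
have icst : P.-integrable setT (fun x : T => (c0 ^+ 2)%:E).
  apply/integrableP; split => //.
  by rewrite integral_cst//= probability_setT mule1 ltry.
rewrite integralD//=; last exact: integrableD.
rewrite integralD//= !integralZl//= integral_cst//= probability_setT mule1 mnE.
have -> : (\int[P]_x (g x ^+ 2)%:E = (fine (\int[P]_x (g x ^+ 2)%:E))%:E)%E.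
  by rewrite fineK//; exact: integrable_fin_num.
move: g2V; rewrite -[X in (X <= _)%E]fineK; last exact: integrable_fin_num.
set I2 := fine _; rewrite lee_fin => IV.
rewrite -!EFinM -!EFinD lee_fin /c0.
have := ler_wpM2l (sqr_ge0 a) IV; have := sqr_ge0 (a * mn); nra.
Qed.

End CenteredMoment.

(** A Cauchy criterion along the scale [1 / (k + 1)], so that its failure is a countable union of
    events, each of which can be shown to be null. *)
Lemma cvgn_of_cauchy_tails {R : realType} (u : R^nat) :
  (forall k : nat, exists n, forall j, `|u (n + j)%N - u n| < k.+1%:R^-1) -> cvgn u.
Proof.
move=> uC; apply/cauchy_cvgP/cauchy_exP => e e0.
have [k ke] : exists k : nat, k.+1%:R^-1 < e.
  exists (Num.truncn e^-1).
  by rewrite -ltf_pV2 ?(posrE,divr_gt0)// invrK truncnS_gt.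
have [n nk] := uC k; exists (u n); exists n => // j /= nj.
rewrite -ball_normE /= distrC -(subnKC nj).
exact: lt_trans (nk _) ke.
Qed.

Lemma cvgn_series_tails {R : realType} (u : R^nat) (e : R) : 0 < e ->
  cvgn (series u) -> exists n, forall j, \sum_(i < j) u (n + i)%N < e.
Proof.
move=> e0 /cauchy_cvgP/cauchy_seriesP/(_ e e0) [[A B] /= [[n _ nA] [n' _ nB]] AB].
exists (maxn n n') => j.
have := AB (maxn n n', maxn n n' + j)%N.
rewrite /= => /(_ (conj (nA _ (leq_maxl _ _)) (nB _ (leq_trans (leq_maxr _ _) (leq_addr _ _))))).
move=> /(le_lt_trans (ler_norm _)); rewrite -{1}[maxn n n']add0n big_addn.
by rewrite addKn big_mkord; under eq_bigr do rewrite addnC.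
Qed.

(* Stopping as soon as the sum leaves ]-e, e[ makes the increments that are
   kept have bounded predictable coefficients. *)
Fixpoint stopped_sum {R : realType} {T : Type} (d : nat -> T -> R) (e : R)
    (n j : nat) (w : T) : R :=
  if j is i.+1 then
    let t := stopped_sum d e n i w in t + (`|t| < e)%R%:R * d (n + i)%N w
  else 0.

Lemma stopped_sumE {R : realType} {T : Type} (d : nat -> T -> R) (e : R) n w :
  0 < e -> (forall j, `|stopped_sum d e n j w| < e) ->
  forall j, stopped_sum d e n j w = \sum_(i < j) d (n + i)%N w.
Proof.
move=> e0 H; elim=> [|j IH]; first by rewrite big_ord0.
by rewrite big_ord_recr /= H mul1r -IH.
Qed.

(** * Almost sure convergence of weighted martingale noise *)

Section Noise.
Context {R : realType} {d d2 : measure_display}.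
Context {Omega : measurableType d} {T : measurableType d2}.
Variable Pr : probability Omega R.
Variable G : nat -> set (set Omega).
Hypothesis G_sub : forall n E, <<s G n >> E -> measurable E.
Hypothesis G_mono : forall n E, <<s G n >> E -> <<s G n.+1 >> E.
Variables (Z : nat -> Omega -> T) (K : nat -> Omega -> probability T R).
Hypothesis mZ : forall n,
  @measurable_fun _ _ (g_sigma_algebraType (G n.+1)) T setT (Z n).
Hypothesis ZK : forall n, is_cond_law Pr <<s G n >> (Z n) (K n).
Variable g : nat -> Omega * T -> R.
Hypothesis mg : forall n,
  @measurable_fun _ _ (g_sigma_algebraType (G n) * T)%type R setT (g n).
Variable V : R.
Hypothesis gV : forall n w, (\int[K n w]_x (g n (w, x) ^+ 2)%:E <= V%:E)%E.
Variable a : nat -> R.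
Hypothesis a2 : cvgn (series (fun n => a n ^+ 2)).

Let F n := g_sigma_algebraType (G n).

Let mK n B : measurable B -> @measurable_fun _ _ (F n) _ setT (fun w => K n w B).
Proof. by move=> /(ZK n)[h _] _ U mU; rewrite setTI; exact: h. Qed.

Let mid n : measurable_fun setT (id : Omega -> F n).
Proof. by move=> _ U mU; rewrite setTI; exact: G_sub mU. Qed.

Let mZO n : measurable_fun setT (Z n).
Proof.
apply: (measurable_fun_coarser (G := G n.+1)); first exact: G_sub.
exact: mZ.
Qed.

(** [Z n] is integrated against [K n] while all that is known at time [n] stays fixed: here [W] is
    the identity, read as a map to [Omega] with the sigma-algebra generated by [G n]. *)
Let freeze n (f : F n * T -> \bar R) : (forall z, (0 <= f z)%E) ->
  measurable_fun setT f ->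
  (\int[Pr]_w f (w, Z n w) = \int[Pr]_w \int[K n w]_x f (w, x))%E.
Proof.
move=> f0 mf; apply: (disintegration (W := id : Omega -> F n)) => //.
- exact: mK.
- by move=> A B mA /(ZK n)[_]; apply.
Qed.

Let V_ge0 : 0 <= V.
Proof.
have w0 : Omega by exact: point.
by rewrite -lee_fin (le_trans _ (gV 0%N w0))// integral_ge0// => x _;
  rewrite lee_fin sqr_ge0.
Qed.

Let mgx n w : measurable_fun setT (fun x => g n (w, x)).
Proof.
apply: (measurableT_comp (f := g n : F n * T -> R)); first exact: mg.
exact: measurable_fun_pair.
Qed.

Let mn n w := \int[K n w]_x g n (w, x).

Let mmn n : @measurable_fun _ _ (F n) _ setT (mn n).
Proof.
have mEg : measurable_fun setT (fun z : F n * T => (g n z)%:E).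
  exact/measurable_EFinP.
rewrite /mn /Rintegral.
apply: (measurableT_comp (f := fine)) => //.
(* A kernel integral of a nonnegative integrand is measurable; the signed one is split into its two
   parts. *)
rewrite (_ : (fun w => _) = (fun w =>
  (\int[K n w]_x ((fun z => (g n z)%:E)^\+ (w, x)) -
   \int[K n w]_x ((fun z => (g n z)%:E)^\- (w, x)))%E)); last first.
  apply/funext => w; rewrite integralE.
  by congr (_ - _)%E; apply: eq_integral => x _; rewrite ?funeposE ?funenegE.
apply: emeasurable_funB.
- apply: (measurable_fun_integral_finite_kernel
    ((fun z : F n * T => (g n z)%:E)^\+)%E
    (prob_kernel_of (K := K n : F n -> _) (@mK n))).
    by move=> z; exact: funepos_ge0.
  exact: measurable_funepos.
- apply: (measurable_fun_integral_finite_kernel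
    ((fun z : F n * T => (g n z)%:E)^\-)%E
    (prob_kernel_of (K := K n : F n -> _) (@mK n))).
    by move=> z; exact: funeneg_ge0.
  exact: measurable_funeneg.
Qed.

Let noise n w := a n * (g n (w, Z n w) - mn n w).

Let F_next n {d'} {U : measurableType d'} (f : Omega -> U) :
  @measurable_fun _ _ (F n) U setT f -> @measurable_fun _ _ (F n.+1) U setT f.
Proof.
move=> mf _ B mB; rewrite setTI; apply: G_mono.
by have := mf measurableT B mB; rewrite setTI.
Qed.

Let mnoise n : @measurable_fun _ _ (F n.+1) _ setT (noise n).
Proof.
apply: measurable_funM => //; apply: measurable_funB; last first.
  by apply: F_next; exact: mmn.
apply: (measurableT_comp (f := g n : F n * T -> R)); first exact: mg.
apply: measurable_fun_pair; last exact: mZ.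
by apply: F_next; exact: measurable_id.
Qed.

(** By Tonelli and the conditional moment bound the whole sum has finite expectation, hence is
    finite almost surely. *)
Lemma cvg_sqr_series :
  {ae Pr, forall w, cvgn (series (fun n => a n ^+ 2 * g n (w, Z n w) ^+ 2))}.
Proof.
pose h n w : \bar R := (a n ^+ 2 * g n (w, Z n w) ^+ 2)%:E.
have h0 n w : (0 <= h n w)%E.
  by rewrite lee_fin; apply: mulr_ge0; exact: sqr_ge0.
have mh n : measurable_fun setT (h n).
  apply/measurable_EFinP; apply: measurable_funM => //; apply: measurable_funX.
  apply: (measurable_fun_coarser (G := G n.+1)); first exact: G_sub.
  apply: (measurableT_comp (f := g n : F n * T -> R)); first exact: mg.
  apply: measurable_fun_pair; last exact: mZ.
  by apply: F_next; exact: measurable_id.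
have ih n : (\int[Pr]_w h n w <= (a n ^+ 2 * V)%:E)%E.
  pose f (z : F n * T) : \bar R := (a n ^+ 2 * g n z ^+ 2)%:E.
  rewrite [leLHS](_ : _ = \int[Pr]_w f (w, Z n w))%E// freeze//; last 2 first.
  - by move=> z; rewrite lee_fin; apply: mulr_ge0; exact: sqr_ge0.
  - apply/measurable_EFinP; apply: measurable_funM => //.
    by apply: measurable_funX; exact: mg.
  apply: (@le_trans _ _ (\int[Pr]_w (cst (a n ^+ 2 * V)%:E w))%E); last first.
    by rewrite integral_cst//= probability_setT mule1.
  apply: ge0_le_integral => //=.
  - move=> w _; apply: integral_ge0 => x _; rewrite lee_fin.
    by apply: mulr_ge0; exact: sqr_ge0.
  - apply: measurable_fun_coarser (G_sub (n := n)) _.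
    apply: (measurable_fun_integral_finite_kernel f
      (prob_kernel_of (K := K n : F n -> _) (@mK n))).
    + by move=> z; rewrite lee_fin; apply: mulr_ge0; exact: sqr_ge0.
    + apply/measurable_EFinP; apply: measurable_funM => //.
      by apply: measurable_funX; exact: mg.
  - move=> w _; rewrite /f /=; under eq_integral => x _ do rewrite EFinM.
    rewrite ge0_integralZl//.
    + rewrite [leRHS]EFinM lee_wpmul2l ?gV ?lee_fin ?sqr_ge0//.
    + by apply/measurable_EFinP; apply: measurable_funX; exact: mgx.
    + by move=> x _; rewrite lee_fin sqr_ge0.
    + by rewrite lee_fin sqr_ge0.
have [B aB] : exists B, forall n, \sum_(0 <= k < n) a k ^+ 2 <= B.
  have /cvg_seq_bounded/bounded_fun_has_ubound[B aB] := a2.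
  by exists B => n; apply: aB; exists n.
have sumh : (\int[Pr]_w (\sum_(n <oo) h n w) <= (B * V)%:E)%E.
  rewrite integral_nneseries//.
  apply: lime_le; first by apply: is_cvg_nneseries => n _ _; exact: integral_ge0.
  apply: nearW => n.
  apply: (@le_trans _ _ (\sum_(0 <= k < n) (a k ^+ 2 * V)%:E)%E).
    by apply: lee_sum => k _; exact: ih.
  by rewrite sumEFin lee_fin -mulr_suml ler_wpM2r.
have ish : Pr.-integrable setT (fun w => \sum_(n <oo) h n w)%E.
  apply/integrableP; split; first by apply: ge0_emeasurable_sum => // k x _ _.
  under eq_integral => w _ do rewrite gee0_abs ?nneseries_ge0//.
  exact: le_lt_trans sumh (ltry _).
have := integrable_ae measurableT ish; apply: filterS => w /(_ I) fin.
apply: nondecreasing_is_cvgn.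
  apply: nondecreasing_series => k _ _.
  by apply: mulr_ge0; exact: sqr_ge0.
exists (fine (\sum_(n <oo) h n w)%E) => _ [n _ <-].
rewrite -lee_fin fineK// /series /= -sumEFin.
by apply: nneseries_lim_ge => k _ _; exact: h0.
Qed.

(** A martingale increment is orthogonal to the past: once the past is frozen, [c] and [i] are
    constants and [centered_moment_le] applies. The factor [i] will be the stopping indicator. *)
Lemma noise_step n (c i : Omega -> R) :
  @measurable_fun _ _ (F n) _ setT c -> @measurable_fun _ _ (F n) _ setT i ->
  (forall w, `|i w| <= 1) ->
  (\int[Pr]_w ((c w + i w * noise n w) ^+ 2)%:E <=
   \int[Pr]_w (c w ^+ 2)%:E + (a n ^+ 2 * V)%:E)%E.
Proof.
move=> mc mi i1.
pose f (z : F n * T) : \bar R :=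
  ((c z.1 + i z.1 * (a n * (g n z - mn n z.1))) ^+ 2)%:E.
have mf : measurable_fun setT f.
  apply/measurable_EFinP; apply: measurable_funX.
  apply: measurable_funD; first exact: (measurableT_comp mc).
  apply: measurable_funM; first exact: (measurableT_comp mi).
  apply: measurable_funM => //; apply: measurable_funB => //.
  apply: (measurableT_comp (f := mn n : F n -> R) (g := fst)); first exact: mmn.
  exact: measurable_fst.
have f0 z : (0 <= f z)%E by rewrite lee_fin sqr_ge0.
rewrite [leLHS](_ : _ = \int[Pr]_w f (w, Z n w))%E//.
rewrite freeze//.
have mcO := measurable_fun_coarser (G_sub (n := n)) mc.
have mc2 : measurable_fun setT (fun w : Omega => (c w ^+ 2)%:E).
  by apply/measurable_EFinP; exact: measurable_funX.
rewrite (_ : (a n ^+ 2 * V)%:E = \int[Pr]_w (cst (a n ^+ 2 * V)%:E w))%E; last first.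
  by rewrite integral_cst//= probability_setT mule1.
rewrite -ge0_integralD//=; last 2 first.
- by move=> w _; rewrite lee_fin sqr_ge0.
- by move=> w _; rewrite lee_fin; apply: mulr_ge0 => //; exact: sqr_ge0.
apply: ge0_le_integral => //=.
- by move=> w _; exact: integral_ge0.
- apply: measurable_fun_coarser (G_sub (n := n)) _.
  exact: (measurable_fun_integral_finite_kernel f
    (prob_kernel_of (K := K n : F n -> _) (@mK n))).
- exact: emeasurable_funD.
- move=> w _; rewrite /f /= -EFinD.
  under eq_integral => x _ do rewrite mulrA.
  apply: (le_trans (centered_moment_le (mgx n w) (gV n w) (c w) (i w * a n))).
  rewrite lee_fin lerD2l exprMn -mulrA ler_piMl//.
    by apply: mulr_ge0 => //; exact: sqr_ge0.
  by rewrite -real_normK ?num_real// expr_le1.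
Qed.

Let stopped := stopped_sum noise.

Let mstop (e : R) (f : Omega -> R) n : @measurable_fun _ _ (F n) _ setT f ->
  @measurable_fun _ _ (F n) _ setT (fun w => (`|f w| < e)%R%:R : R).
Proof.
move=> mf; apply: (measurableT_comp (f := fun t : R => (`|t| < e)%R%:R : R)) => //.
rewrite [X in measurable_fun _ X](_ : _ = \1_[set t : R | `|t| < e]); last first.
  by apply/funext => t; rewrite indicE; congr (nat_of_bool _)%:R;
    apply/idP/idP; rewrite inE.
apply: measurable_indic.
rewrite (_ : [set _ | _] = setT `&` Num.norm @^-1` `]-oo, e[%classic).
  exact: normr_measurable.
by apply/seteqP; split => t /=; rewrite in_itv/= => // -[].
Qed.

Let mstopped e n j : @measurable_fun _ _ (F (n + j)) _ setT (stopped e n j).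
Proof.
elim: j => [|j IH]; first exact: measurable_cst.
rewrite /stopped /= addnS; apply: measurable_funD; first exact: F_next.
apply: measurable_funM; last exact: mnoise.
by apply: F_next; exact: mstop.
Qed.

Let mstoppedO e n j : measurable_fun setT (stopped e n j).
Proof.
apply: (measurable_fun_coarser (G := G (n + j))); first exact: G_sub.
exact: mstopped.
Qed.

Let stopped_moment e n j :
  (\int[Pr]_w (stopped e n j w ^+ 2)%:E <=
   (V * \sum_(i < j) a (n + i)%N ^+ 2)%:E)%E.
Proof.
elim: j => [|j IH].
  by rewrite /stopped /= expr0n /= big_ord0 mulr0 integral0.
apply: (le_trans (noise_step (n := (n + j)%N)
  (i := fun w => (`|stopped e n j w| < e)%R%:R) (@mstopped e n j) _ _)).
- by apply: mstop; exact: mstopped.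
- by move=> w; case: (_ < _); rewrite ?normr1 ?normr0.
rewrite big_ord_recr /= mulrDr EFinD [(V * a _ ^+ 2)%R]mulrC.
exact: leeD.
Qed.

Let exits e n j := [set w : Omega | e <= `|stopped e n j w|].

Let mexits e n j : measurable (exits e n j).
Proof.
rewrite (_ : exits _ _ _ = setT `&` (fun w => `|stopped e n j w|) @^-1` `[e, +oo[%classic).
  have : measurable_fun setT (fun w => `|stopped e n j w|) by exact: measurableT_comp.
  by apply.
by apply/seteqP; split => t /=; rewrite /exits /= in_itv/= andbT => // -[].
Qed.

(** Chebyshev's inequality for the stopped sum. *)
Let exits_le e n j : 0 < e ->
  ((e ^+ 2)%:E * Pr (exits e n j) <= (V * \sum_(i < j) a (n + i)%N ^+ 2)%:E)%E.
Proof.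
move=> e0; apply: le_trans (stopped_moment e n j).
rewrite -integral_cst//; apply: (@le_trans _ _
  (\int[Pr]_(w in exits e n j) (stopped e n j w ^+ 2)%:E)%E).
  apply: ge0_le_integral => //=.
  - by move=> w _; rewrite lee_fin sqr_ge0.
  - by apply/measurable_EFinP; apply: measurable_funX; exact: measurable_funTS.
  - move=> w ew; rewrite lee_fin -[leRHS]real_normK ?num_real//.
    by rewrite lerXn2r// nnegrE// ltW.
apply: ge0_subset_integral => //=.
- by apply/measurable_EFinP; exact: measurable_funX.
- by move=> w _; rewrite lee_fin sqr_ge0.
Qed.

(** Kolmogorov's maximal inequality: a stopped sum that has left the interval stays where it is, so
    the exit events increase with [j] and Chebyshev's bound passes to their union. *)
Let exits_bigcup_le e n s : 0 < e -> (forall j, \sum_(i < j) a (n + i)%N ^+ 2 <= s) ->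
  ((e ^+ 2)%:E * Pr (\bigcup_j exits e n j) <= (V * s)%:E)%E.
Proof.
move=> e0 sP.
have nd : nondecreasing_seq (exits e n).
  apply/nondecreasing_seqP => j; rewrite subsetEset /exits /stopped => w /= ew.
  by rewrite ltNge ew /= mul0r addr0.
have := nondecreasing_cvg_mu (mu := Pr) (mexits e n) _ nd.
move=> /(_ (bigcup_measurable (fun j _ => mexits e n j))) cv.
rewrite -lee_pdivlMl ?exprn_gt0// -EFinM.
apply: cvge_le cv; apply: nearW => j /=.
rewrite EFinM lee_pdivlMl ?exprn_gt0//.
by apply: (le_trans (exits_le _ _ e0)); rewrite lee_fin ler_wpM2l.
Qed.

Lemma noise_cvg : {ae Pr, forall w,
  cvgn (series (fun n => a n * (g n (w, Z n w) - \int[K n w]_x g n (w, x))))}.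
Proof.
pose e (k : nat) : R := k.+1%:R^-1.
have e0 k : 0 < e k by rewrite invr_gt0.
(* On [N k] the sum started at any index [n] leaves the interval of radius [e k]; off all the [N k]
   the partial sums are Cauchy. *)
pose N k := \bigcap_n \bigcup_j exits (e k) n j.
have mU k n : measurable (\bigcup_j exits (e k) n j) by exact: bigcup_measurable.
have mN k : measurable (N k) by apply: bigcap_measurable.
have N0 k : Pr (N k) = 0%E.
  apply/eqP; rewrite eq_le measure_ge0 andbT; apply/lee_addgt0Pr => s s0.
  (* A tail of this size makes the maximal inequality give at most [s]; [V + 1] keeps the divisor
     positive when [V] is zero. *)
  have t0 : 0 < e k ^+ 2 * s / (V + 1).
    by rewrite divr_gt0 ?mulr_gt0 ?exprn_gt0// ltr_wpDl.
  have [n nP] := cvgn_series_tails t0 a2.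
  rewrite add0e; apply: (@le_trans _ _ (Pr (\bigcup_j exits (e k) n j))).
    by apply: le_measure; rewrite ?inE//; by move=> w /(_ n I).
  rewrite -(@lee_pmul2l _ (e k ^+ 2)%:E)// ?lte_fin ?exprn_gt0//.
  apply: (le_trans (exits_bigcup_le (e0 k) (fun j => ltW (nP j)))).
  rewrite -EFinM lee_fin mulrA ler_pdivrMr ?ltr_wpDl//.
  have : 0 <= e k ^+ 2 * s by rewrite mulr_ge0 ?exprn_ge0// ltW.
  nra.
apply: (@negligibleS _ _ _ _ (\bigcup_k N k)); last first.
  by apply: negligible_bigcup => k; exists (N k); split; [exact: mN|exact: N0|].
move=> w /= ncv; apply: contrapT => wN; apply: ncv.
apply: cvgn_of_cauchy_tails => k.
have {}wN : ~ N k w by move=> ?; apply: wN; exists k.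
have [n nP] : exists n, ~ (\bigcup_j exits (e k) n j) w.
  by apply: contrapT => /forallNP h; apply: wN => n _; apply: contrapT; exact: h.
have inside j : `|stopped (e k) n j w| < e k.
  by rewrite ltNge; apply/negP => h; apply: nP; exists j.
exists n => j; rewrite -/(e k).
have := inside j; rewrite /stopped stopped_sumE//.
rewrite sub_series_geq ?leq_addr// -[X in \sum_(X <= _ < _) _]add0n big_addn addKn big_mkord.
by congr (`|_| < _); apply: eq_bigr => i _; rewrite addnC.
Qed.

End Noise.

(** * Borel structure of matrices *)

Section BorelMatrix.
Context {R : realType} {m n : nat}.
Notation Mx := 'M[R]_(m, n).

Lemma measurable_of_open (U : set Mx) : open U -> measurable U.
Proof. by move=> oU; exact: sub_sigma_algebra. Qed.

Lemma continuous_measurable (f : Mx -> R) : continuous f -> measurable_fun setT f.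
Proof.
move=> /continuousP cf; apply: (measurability _ (RGenOpens.measurableE R)).
move=> _ [_ [a [b ->] <-]]; rewrite setTI; apply: measurable_of_open.
by apply: cf; exact: interval_open.
Qed.

Lemma measurable_entry i j : measurable_fun setT (fun x : Mx => x i j).
Proof. apply: continuous_measurable; exact: coord_continuous. Qed.

(** A countable base of the topology: balls of the sup norm, which are boxes, with rational centre
    and radius [1 / (l + 1)]. The option comes from [unpickle]. *)
Let rat_box (k : nat) : option (set Mx) :=
  omap (fun z : 'M[rat]_(m, n) * nat => ball (map_mx ratr z.1 : Mx) z.2.+1%:R^-1)
    (unpickle k).

Let rat_box_cover (U : set Mx) : open U ->
  U = \bigcup_k (if rat_box k is Some B then
                   if `[< B `<=` U >] then B else set0 else set0).
Proof.
move=> oU; apply/seteqP; split => [x Ux|x [k _]]; last first.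
  by case: (rat_box k) => // B; case: asboolP => // BU; exact: BU.
have /nbhs_ballP[e /= e0 eU] : nbhs x U by exact: open_nbhs_nbhs.
have [k ke] : exists k : nat, k.+1%:R^-1 < e / 2.
  exists (Num.truncn (e / 2)^-1).
  by rewrite -ltf_pV2 ?(posrE,divr_gt0)// invrK truncnS_gt.
have k0 : 0 < k.+1%:R^-1 :> R by rewrite invr_gt0.
have qx i j : {q : rat | `|ratr q - x i j| < k.+1%:R^-1}.
  apply: cid; have /rat_in_itvoo[q] : x i j - k.+1%:R^-1 < x i j + k.+1%:R^-1.
    by rewrite ltrD2l gt0_cp.
  rewrite in_itv/= => /andP[h1 h2]; exists q; rewrite ltr_norml.
  by move: h1 h2; move: (k.+1%:R^-1) => e' h1 h2; apply/andP; split; lra.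
pose q : 'M[rat]_(m, n) := \matrix_(i, j) sval (qx i j).
exists (pickle (q, k)) => //; rewrite /rat_box pickleK /=.
have xq : ball (map_mx ratr q : Mx) k.+1%:R^-1 x.
  by split => // i j; rewrite -ball_normE /= !mxE; case: (qx i j).
case: asboolP => // -[] y qy; apply: eU.
apply: (@ball_splitr R Mx (map_mx ratr q : Mx)); first exact: le_ball (ltW ke) _ xq.
exact: le_ball (ltW ke) _ qy.
Qed.

(** The sigma-algebra is generated by the open sets and not by the coordinates. By second
    countability an open set is a countable union of boxes, and the preimage of a box is a finite
    intersection of conditions on entries. *)
Lemma measurable_fun_entries {d} {T : measurableType d} (D : set T) (f : T -> Mx) :
  (forall i j, measurable_fun D (fun w => f w i j)) -> measurable_fun D f.
Proof.
move=> mf mD; apply: (@measurability _ _ _ _ _ _ (@open Mx)) => // _ [U oU <-].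
rewrite (rat_box_cover oU) preimage_bigcup setI_bigcupr.
apply: bigcupT_measurable => k; rewrite /rat_box.
case: (unpickle k) => [[q l]|] /=; last by rewrite preimage_set0 setI0.
case: asboolP => _; last by rewrite preimage_set0 setI0.
have l0 : 0 < l.+1%:R^-1 :> R by rewrite invr_gt0.
pose E (t : 'I_m * 'I_n) :=
  D `&` (fun w => f w t.1 t.2) @^-1` ball (ratr (q t.1 t.2) : R) l.+1%:R^-1.
rewrite (_ : _ `&` _ = D `&` \bigcap_(t in [set` index_enum _]) E t).
  rewrite bigcap_seq; apply: measurableI => //.
  apply: big_ind => [|A B|t _]; [exact: measurableT|exact: measurableI|].
  by apply: mf => //; apply: open_measurable; exact: ball_open.
apply/seteqP; split => w /= [Dw]; rewrite /bigcap /= => Bw; split => //.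
  by move=> t _; split => //; have := Bw.2 t.1 t.2; rewrite mxE.
by split => // i j; have [_] := Bw (i, j) (mem_index_enum _); rewrite /= mxE.
Qed.

(* Such a [g] is a function of [f], and its superlevel sets are preimages of
   open sets, whatever the range of [f] is. *)
Lemma measurable_lipschitz {d} {T : measurableType d} (f : T -> Mx) (g : T -> R) (L : R) :
  0 < L -> measurable_fun setT f ->
  (forall w w', `|g w - g w'| <= L * `|f w - f w'|) ->
  measurable_fun setT g.
Proof.
move=> L0 mf gL; apply: (measurability _ (RGenOInfty.measurableE R)).
move=> _ [_ [c ->] <-]; rewrite setTI.
pose V := \bigcup_(w' in [set w' | c < g w']) ball (f w') ((g w' - c) / L).
rewrite (_ : _ @^-1` _ = setT `&` f @^-1` V).
  apply: mf => //; apply: measurable_of_open; apply: bigcup_open => w' /= cw'.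
  by apply: ball_open; rewrite divr_gt0// subr_gt0.
apply/seteqP; split => w /=; rewrite in_itv/= andbT.
  move=> cw; split => //; exists w => //; apply: ballxx.
  by rewrite divr_gt0// subr_gt0.
move=> [_ [w' /= cw']]; rewrite -ball_normE /= ltr_pdivlMr// mulrC => Lw.
by have := le_lt_trans (gL w' w) Lw; rewrite ltr_norml => /andP[]; lra.
Qed.

End BorelMatrix.

(** * Euclidean geometry *)

Section EuclideanTheory.
Context {R : realType} {n : nat}.
Implicit Types u v w : 'cV[R]_n.

Lemma dotvC u v : dotv u v = dotv v u.
Proof. by apply: eq_bigr => i _; rewrite mulrC. Qed.

Lemma dotvDl u v w : dotv (u + v) w = dotv u w + dotv v w.
Proof. by rewrite /dotv -big_split; apply: eq_bigr => i _; rewrite mxE mulrDl. Qed.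

Lemma dotvZl (c : R) u v : dotv (c *: u) v = c * dotv u v.
Proof. by rewrite /dotv mulr_sumr; apply: eq_bigr => i _; rewrite mxE mulrA. Qed.

Lemma dotvNl u v : dotv (- u) v = - dotv u v.
Proof. by rewrite -scaleN1r dotvZl mulN1r. Qed.

Lemma dotvDr u v w : dotv w (u + v) = dotv w u + dotv w v.
Proof. by rewrite dotvC dotvDl !(dotvC w). Qed.

Lemma dotvZr (c : R) u v : dotv u (c *: v) = c * dotv u v.
Proof. by rewrite dotvC dotvZl dotvC. Qed.

Lemma dotvNr u v : dotv u (- v) = - dotv u v.
Proof. by rewrite dotvC dotvNl dotvC. Qed.

Lemma dotv0l u : dotv 0 u = 0.
Proof. by rewrite -(scale0r u) dotvZl mul0r. Qed.

Definition dotvE := (dotvDl, dotvDr, dotvNl, dotvNr, dotvZl, dotvZr).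

Lemma dotv_delta u i : dotv u (delta_mx i 0) = u i 0.
Proof.
rewrite /dotv (bigD1 i)//= big1 => [|j ji]; first by rewrite mxE !eqxx mulr1 addr0.
by rewrite mxE (negbTE ji) mulr0.
Qed.

Lemma dotv_suml I (r : seq I) (f : I -> 'cV[R]_n) v :
  dotv (\sum_(i <- r) f i) v = \sum_(i <- r) dotv (f i) v.
Proof.
by apply: (big_morph (fun u => dotv u v)) => [u w|]; rewrite ?dotvDl ?dotv0l.
Qed.

Lemma dotvv_ge0 u : 0 <= dotv u u.
Proof. by apply: sumr_ge0 => i _; rewrite -expr2 sqr_ge0. Qed.

Lemma sqr_entry_le u i : u i 0 ^+ 2 <= dotv u u.
Proof.
rewrite /dotv (bigD1 i)//= -expr2 lerDl.
by apply: sumr_ge0 => j _; rewrite -expr2 sqr_ge0.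
Qed.

Lemma dotvv_eq0 u : dotv u u = 0 -> u = 0.
Proof.
move=> u0; apply/colP => i; have := sqr_entry_le u i.
rewrite u0 [in RHS]mxE => h; apply/eqP; rewrite -sqrf_eq0 eq_le h /=.
exact: sqr_ge0.
Qed.

Lemma enorm_sqr u : enorm u ^+ 2 = dotv u u.
Proof. by rewrite sqr_sqrtr// dotvv_ge0. Qed.

Lemma enorm_ge0 u : 0 <= enorm u. Proof. exact: sqrtr_ge0. Qed.

Lemma dotv_sqr_le u v : dotv u v ^+ 2 <= dotv u u * dotv v v.
Proof.
have [v0|v0] := eqVneq v 0; first by rewrite v0 dotvC !dotv0l mulr0 expr0n.
have vv : 0 < dotv v v.
  rewrite lt_def dotvv_ge0 andbT; apply: contra_neq v0; exact: dotvv_eq0.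
(* The squared norm of this vector is the Cauchy-Schwarz gap times [dotv v v]. *)
have := dotvv_ge0 (dotv v v *: u - dotv u v *: v).
have -> : dotv (dotv v v *: u - dotv u v *: v) (dotv v v *: u - dotv u v *: v) =
    dotv v v * (dotv u u * dotv v v - dotv u v ^+ 2).
  by rewrite !dotvE (dotvC v u); ring.
by rewrite pmulr_rge0// subr_ge0.
Qed.

Lemma dotv_le u v : `|dotv u v| <= enorm u * enorm v.
Proof.
rewrite -(@ler_pXn2r _ 2)// ?nnegrE ?mulr_ge0 ?enorm_ge0//.
by rewrite exprMn !enorm_sqr real_normK ?num_real// dotv_sqr_le.
Qed.

Lemma entry_le_enorm u i : `|u i 0| <= enorm u.
Proof.
rewrite -(@ler_pXn2r _ 2)// ?nnegrE ?enorm_ge0//.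
by rewrite enorm_sqr real_normK ?num_real// sqr_entry_le.
Qed.

(** The constant [n + 1], larger than the optimal square root of [n], stays positive in dimension 0,
    as a Lipschitz constant in [measurable_lipschitz] must. *)
Lemma enorm_le_sup u : enorm u <= n.+1%:R * `|u|.
Proof.
rewrite -(@ler_pXn2r _ 2)// ?nnegrE ?enorm_ge0 ?mulr_ge0//.
rewrite enorm_sqr; apply: (@le_trans _ _ (\sum_(i < n) `|u| ^+ 2)).
  apply: ler_sum => i _; rewrite -expr2 -real_normK ?num_real//.
  rewrite lerXn2r ?nnegrE//.
  by rewrite [leRHS]mx_normrE; apply: (le_bigmax _ (fun ij => `|u ij.1 ij.2|) (i, 0)).
rewrite sumr_const card_ord -[_ *+ n]mulr_natl exprMn ler_wpM2r ?sqr_ge0//.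
by rewrite -natrX ler_nat (leq_trans (leqnSn n))// -{1}[n.+1]expn1 leq_pexp2l.
Qed.

Lemma sup_le_enorm u : `|u| <= enorm u.
Proof.
rewrite [leLHS]mx_normrE; apply/bigmax_leP; split => [|[i j] _ /=]; first exact: enorm_ge0.
by rewrite ord1 entry_le_enorm.
Qed.

End EuclideanTheory.

Lemma dotv_mulmx {R : realType} (p n : nat) (B : 'M[R]_(p, n)) u v :
  dotv (B^T *m u) v = dotv u (B *m v).
Proof.
rewrite /dotv; under eq_bigr => i _ do rewrite mxE mulr_suml.
rewrite exchange_big; apply: eq_bigr => j _; rewrite mxE mulr_sumr.
by apply: eq_bigr => i _; rewrite mxE; ring.
Qed.

(** Cauchy-Schwarz row by row. The constant is the squared Frobenius norm, plus 1 so that one may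
    divide by it. *)
Lemma mulmx_bound {R : realType} (p n : nat) (B : 'M[R]_(p, n)) :
  exists2 c, 0 < c & forall u, dotv (B *m u) (B *m u) <= c * dotv u u.
Proof.
exists (1 + \sum_i dotv (row i B)^T (row i B)^T).
  by rewrite ltr_wpDr// sumr_ge0// => i _; exact: dotvv_ge0.
move=> u; rewrite mulrDl mul1r ler_wpDl ?dotvv_ge0//.
rewrite mulr_suml; apply: ler_sum => i _; rewrite -expr2.
apply: le_trans (dotv_sqr_le _ _); rewrite le_eqVlt; apply/orP; left; apply/eqP.
by congr (_ ^+ 2); rewrite mxE; apply: eq_bigr => j _; rewrite !mxE.
Qed.

(** * Polyhedra and projections *)

Section PolyhedronTheory.
Context {R : realType} {p n : nat}.
Variables (A : 'M[R]_(p, n)) (b : 'cV[R]_p).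
Implicit Types x t u : 'cV[R]_n.

Lemma polyhedron_segment x t (c : R) : polyhedron A b x -> polyhedron A b t ->
  0 <= c <= 1 -> polyhedron A b (x + c *: (t - x)).
Proof.
move=> Ax At /andP[c0 c1] i.
rewrite mulmxDr -scalemxAr mulmxBr; move: (Ax i) (At i).
by move: (A *m x) (A *m t) => v w; rewrite !mxE; nra.
Qed.

Lemma inactive_slack x : exists2 e : R, 0 < e &
  forall u, dotv u u < e -> forall i, (A *m x) i 0 < b i 0 ->
    `|(A *m u) i 0| < b i 0 - (A *m x) i 0.
Proof.
have [c c0 cP] := mulmx_bound A.
(* The smallest slack, capped at 1; the cap is the value when no constraint is inactive. *)
pose s := \big[Num.min/1%R]_(i | (A *m x) i 0 < b i 0) (b i 0 - (A *m x) i 0).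
have s0 : 0 < s.
  by apply/bigmin_gtP; split => // i xi; rewrite subr_gt0.
exists (s ^+ 2 / c); first by rewrite divr_gt0 ?exprn_gt0.
move=> u us i xi; apply: (@lt_le_trans _ _ s); last exact: bigmin_le_cond.
rewrite -(@ltr_pXn2r _ 2)// ?nnegrE ?ltW//.
rewrite real_normK ?num_real// (le_lt_trans (sqr_entry_le _ _))//.
by rewrite (le_lt_trans (cP u))// mulrC -ltr_pdivlMr.
Qed.

(* The reflected point [x + (x - x0)] is feasible when [x] is close to [x0]. *)
Lemma normal_cone_local x0 : polyhedron A b x0 -> exists2 e : R, 0 < e &
  forall x y, polyhedron A b x -> dotv (x - x0) (x - x0) < e ->
    (forall t, polyhedron A b t -> dotv (y - x) (t - x) <= 0) ->
    dotv (y - x) (x - x0) <= 0.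
Proof.
move=> Ax0; have [e e0 eP] := inactive_slack x0.
(* The reflected point is [x0 + 2 *: u], whose squared displacement from [x0] is four times that of
   [x]. *)
exists (e / 4); first by rewrite divr_gt0.
move=> x y Ax xe VI; have [u uE] : exists u, u = x - x0 by exists (x - x0).
have xE : x = x0 + u by rewrite uE addrC subrK.
rewrite -!uE in xe *; have -> : u = (x + u) - x by rewrite addrAC subrr add0r.
apply: VI => i.
have u4 : dotv (2 *: u) (2 *: u) < e by rewrite dotvZl dotvZr; lra.
have := eP _ u4 i; move: (Ax i) (Ax0 i); rewrite xE -addrA !mulmxDr -scalemxAr.
move: (A *m x0) (A *m u) => v w; rewrite !mxE => ? ? vi.
have [/vi|] := ltP (v i 0) (b i 0); last by lra.
by move=> /(le_lt_trans (ler_norm _)); lra.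
Qed.

End PolyhedronTheory.

(** The limit [t -> 0] of a first-order condition. Were [c] negative, [t = min 1 (- c / (2 * e))]
    would make the sum at most [c / 2]. *)
Lemma ge0_of_small_perturbation {R : realType} (c e : R) :
  (forall t, 0 < t <= 1 -> 0 <= c + t * e) -> 0 <= c.
Proof.
move=> H; rewrite leNgt; apply/negP => c0.
have e0 : 0 < e by have := H 1; rewrite ltr01 lexx mul1r => /(_ isT); lra.
have ce : 0 < - c / (2 * e) by rewrite divr_gt0 ?mulr_gt0 ?oppr_gt0.
have := H (Num.min 1 (- c / (2 * e))).
rewrite lt_min ltr01 ce /= ge_min lexx /= => /(_ isT).
set t := Num.min _ _; have : t <= - c / (2 * e) by rewrite ge_min lexx orbT.
rewrite ler_pdivlMr ?mulr_gt0//; nra.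
Qed.

(** First-order optimality along the segment from [x] to [t]. The conclusion characterizes [x] as
    the Euclidean projection of [x0 - z]. *)
Lemma argmin_variational {R : realType} (p n : nat) (A : 'M[R]_(p, n)) b z x0 x :
  polyhedron A b x ->
  (forall t, polyhedron A b t ->
     dotv z x + 2^-1 * dotv (x - x0) (x - x0) <=
     dotv z t + 2^-1 * dotv (t - x0) (t - x0)) ->
  forall t, polyhedron A b t -> dotv (x0 - z - x) (t - x) <= 0.
Proof.
move=> Ax xmin t At; rewrite -oppr_ge0.
apply: (@ge0_of_small_perturbation _ _ (2^-1 * dotv (t - x) (t - x))).
move=> c /andP[c0 c1].
have c01 : 0 <= c <= 1 by rewrite ltW.
have := xmin _ (polyhedron_segment Ax At c01).
have -> : x + c *: (t - x) - x0 = (x - x0) + c *: (t - x) by rewrite addrAC.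
have -> : x0 - z - x = - (x - x0) - z by rewrite opprB addrAC.
move: (t - x) (x - x0) => u v; rewrite !dotvE (dotvC u v) -(pmulr_rge0 _ c0).
lra.
Qed.

Lemma cvgn_series_eventually_bounded {R : realType} (u : R^nat) (N : nat) (B : R) :
  (forall k, 0 <= u k) -> (forall n, (N <= n)%N -> series u n <= B) -> cvgn (series u).
Proof.
move=> u0 uB.
have nd : nondecreasing_seq (series u) by apply: nondecreasing_series.
apply: nondecreasing_is_cvgn => //; exists B => _ [n _ <-].
apply: le_trans (uB (maxn n N) (leq_maxr _ _)).
by apply: nd; exact: leq_maxl.
Qed.

Lemma cvgn_bounded {R : realType} (u : R^nat) :
  cvgn u -> exists B, forall n, `|u n| <= B.
Proof.
move=> /cvg_seq_bounded [M [Mreal]]/(_ (`|M| + 1)).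
rewrite (le_lt_trans (ler_norm _)) ?ltrDl// => /(_ erefl) uM.
by exists (`|M| + 1) => n; apply: uM.
Qed.

(** Projections are nonexpansive: each variational inequality is tested at the other point, the two
    are added, and Cauchy-Schwarz concludes. *)
Lemma projection_lipschitz {R : realType} (n : nat) (D : set 'cV[R]_n) x x' y y' :
  D x -> D x' ->
  (forall t, D t -> dotv (y - x) (t - x) <= 0) ->
  (forall t, D t -> dotv (y' - x') (t - x') <= 0) ->
  enorm (x - x') <= enorm (y - y').
Proof.
move=> Dx Dx' /(_ _ Dx') h /(_ _ Dx) h'.
have e0 := enorm_ge0 (x - x').
have xy : dotv (x - x') (x - x') <= dotv (y - y') (x - x').
  by move: h h'; rewrite !dotvE (dotvC x' x); lra.
have [->|x0] := eqVneq (enorm (x - x')) 0; first exact: enorm_ge0.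
have {}x0 : 0 < enorm (x - x') by rewrite lt_def x0.
rewrite -(ler_pM2r x0) -expr2 enorm_sqr (le_trans xy)//.
exact: le_trans (ler_norm _) (dotv_le _ _).
Qed.

(** * Convergence of dual averaging along one path *)

Section DualAveragingPath.
Context {R : realType} {p n : nat}.
Variables (A : 'M[R]_(p, n)) (b : 'cV[R]_p) (x0 xs : 'cV[R]_n).
Variables (a : nat -> R) (g x : nat -> 'cV[R]_n).
Let D := polyhedron A b.
Let y k := x0 - \sum_(i < k) a i *: g i.
Hypotheses (Dxs : D xs) (Dx : forall k, D (x k)).
Hypothesis VI : forall k t, D t -> dotv (y k - x k) (t - x k) <= 0.
Hypothesis a0 : forall k, 0 <= a k.
Hypothesis a_dvg : ~ cvgn (series a).

Let q k := dotv (x k - xs) (x k - xs).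
(* Equal to [(|y k - xs|^2 - |y k - x k|^2) / 2]; by [normal_cone_local] the
   second term is nonpositive as soon as [x k] is close to [xs]. *)
Let energy k := 2^-1 * q k + dotv (y k - x k) (x k - xs).

Let energy_ge k : 2^-1 * q k <= energy k.
Proof.
rewrite /energy lerDl; have := VI k Dxs.
by rewrite -(opprB (x k) xs) dotvNr oppr_le0.
Qed.

(** The variational inequality at time [k] is tested at [x k.+1]; the product of the move
    [x k.+1 - x k] with [a k *: g k] is absorbed by completing the square. *)
Let energy_step k : energy k.+1 <=
  energy k - a k * dotv (g k) (x k - xs) + 2^-1 * (a k ^+ 2 * dotv (g k) (g k)).
Proof.
have VIk := VI k (Dx k.+1).
have yS : y k.+1 = y k - a k *: g k by rewrite /y big_ord_recr /= opprD addrA.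
have := dotvv_ge0 (x k.+1 - x k + a k *: g k).
rewrite /energy /q yS; move: VIk; move: (y k) (x k) (x k.+1) (g k) (a k) => Y X X' G c.
rewrite !dotvE (dotvC X' X) (dotvC Y X) (dotvC Y X') (dotvC G X) (dotvC G X') (dotvC Y xs) (dotvC X xs) (dotvC X' xs) (dotvC G xs).
lra.
Qed.

(** [mm k] stands for the conditional mean of [dotv (g k) (x k - xs)], [e k] for the error tolerated
    in the drift, and [N] for the time from which the drift inequality holds. *)
Variables (c : R) (mm e : nat -> R) (N : nat).
Hypothesis c0 : 0 < c.
Hypothesis noise :
  cvgn (series (fun k => a k * (dotv (g k) (x k - xs) - mm k))).
Hypothesis sq : cvgn (series (fun k => a k ^+ 2 * dotv (g k) (g k))).
Hypothesis drift : forall k, (N <= k)%N -> c * q k - e k <= mm k.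
Hypothesis err : cvgn (series (fun k => a k * e k)).

Let s1 := series (fun k => a k * (dotv (g k) (x k - xs) - mm k)).
Let s2 := series (fun k => a k ^+ 2 * dotv (g k) (g k)).
Let s3 := series (fun k => a k * e k).
Let s4 := series (fun k => a k * q k).
Let s k := s1 k - 2^-1 * s2 k - s3 k.
(** The energy corrected by all perturbations met so far, a pathwise form of the Robbins-Siegmund
    supermartingale. *)
Let U k := energy k + s k + c * s4 k.

Let cvg_s : cvgn s.
Proof.
by apply: is_cvgB => //; apply: is_cvgB => //; exact: is_cvgZl_tmp.
Qed.

Let U_noninc k : (N <= k)%N -> U k.+1 <= U k.
Proof.
move=> Nk; rewrite /U /s /s1 /s2 /s3 /s4 !seriesSr.
have := energy_step k; have := ler_wpM2l (a0 k) (drift Nk); lra.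
Qed.

Lemma dual_averaging_cvg : cvgn s4 /\ q k @[k --> \oo] --> 0.
Proof.
have [B sB] := cvgn_bounded cvg_s.
have q0 k : 0 <= q k by exact: dotvv_ge0.
have aq0 k : 0 <= a k * q k by exact: mulr_ge0.
have en0 k : 0 <= energy k.
  by apply: le_trans (energy_ge k); rewrite mulr_ge0.
have UN j : U (j + N)%N <= U N.
  by elim: j => // j; apply: le_trans; rewrite addSn; apply: U_noninc; rewrite leq_addl.
have UE k : U k = energy k + s k + c * s4 k by [].
have cvg_s4 : cvgn s4.
  apply: (@cvgn_series_eventually_bounded _ _ N (c^-1 * (U N + B))) => // k Nk.
  rewrite ler_pdivlMl//; have := UN (k - N)%N; rewrite subnK// UE.
  have := en0 k; have := sB k; rewrite ler_norml => /andP[]; rewrite -/s4; lra.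
split=> //.
have s4_0 k : 0 <= s4 k by apply: sumr_ge0.
have cvgU : cvgn U.
  suff : cvgn (fun j => U (j + N)%N) by move=> /cvg_ex[l]; rewrite cvg_shiftn => /cvgP.
  apply: nonincreasing_is_cvgn.
    by apply/nonincreasing_seqP => j; rewrite addSn; apply: U_noninc; rewrite leq_addl.
  exists (- B) => _ [j _ <-]; rewrite UE.
  have := sB (j + N)%N; rewrite ler_norml => /andP[? _].
  have := mulr_ge0 (ltW c0) (s4_0 (j + N)%N); have := en0 (j + N)%N; lra.
have : cvgn energy.
  rewrite (_ : energy = (fun k => U k - s k - c * s4 k)); last first.
    by apply/funext => k; rewrite /U; lra.
  by apply: is_cvgB; [exact: is_cvgB|exact: is_cvgZl_tmp].
move=> /cvg_ex[rho enrho].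
suff rho0 : rho <= 0.
  have {}rho0 : rho = 0.
    apply/eqP; rewrite eq_le rho0 /= -(cvg_lim _ enrho)//.
    by apply: limr_ge; [exact: cvgP enrho|exact: nearW].
  apply: (@squeeze_cvgr _ _ _ _ (cst 0) (fun k => 2 * energy k)).
  - apply: nearW => k; rewrite q0 /=; have := energy_ge k; lra.
  - exact: cvg_cst.
  - by rewrite -(mulr0 2) -rho0; exact: cvgMl_tmp.
rewrite leNgt; apply/negP => rho0.
have [eps eps0 local] := normal_cone_local Dxs.
(* If [q k < eps], the second term of the energy is nonpositive, so [q k] is at least twice the
   energy, hence above [rho] once the energy exceeds [rho / 2]. *)
pose eta := Num.min eps rho.
have eta0 : 0 < eta by rewrite lt_min eps0.
apply: a_dvg.
have [K _ Kr] : \forall k \near \oo, rho / 2 < energy k.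
  by apply: (cvgr_gt _ enrho); lra.
have qK k : (K <= k)%N -> eta <= q k.
  move=> /Kr /=; rewrite /energy ge_min; have [//|qe en] := leP eps (q k).
  by have := local _ _ (Dx k) qe (VI k); lra.
apply: (@cvgn_series_eventually_bounded _ _ K
         (series a K + eta^-1 * limn s4)) => // l Kl.
rewrite -lerBlDl sub_series_geq// ler_pdivlMl//.
apply: (@le_trans _ _ (s4 l - s4 K)); last first.
  have : s4 l <= limn s4.
    by apply: nondecreasing_cvgn_le => //; exact: nondecreasing_series.
  have := s4_0 K; lra.
rewrite sub_series_geq// mulr_sumr; apply: ler_sum_nat => k /andP[Kk _].
by rewrite mulrC ler_wpM2l// qK.
Qed.

End DualAveragingPath.

(** * Identification of the active face *)

(** This norm fits strict complementarity: the residuals of the active constraints are nonpositive,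
    so pairing them with a positive multiplier gives, in absolute value, at least its smallest entry
    times their [l1norm]. *)
Definition l1norm {R : realType} {n : nat} (u : 'cV[R]_n) : R := \sum_i `|u i 0|.

Section L1Norm.
Context {R : realType}.

Lemma l1norm_ge0 n (u : 'cV[R]_n) : 0 <= l1norm u.
Proof. exact: sumr_ge0. Qed.

Lemma l1norm_eq0 n (u : 'cV[R]_n) : l1norm u = 0 -> u = 0.
Proof.
move=> u0; apply/colP => i; rewrite mxE; apply/normr0_eq0/eqP.
by rewrite eq_le normr_ge0 andbT -u0 /l1norm (bigD1 i)//= lerDl sumr_ge0.
Qed.

Lemma dotv_le_l1 n (u v : 'cV[R]_n) : `|dotv u v| <= l1norm u * l1norm v.
Proof.
rewrite (le_trans (ler_norm_sum _ _ _))// /l1norm mulr_suml.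
apply: ler_sum => i _; rewrite normrM ler_wpM2l//.
by rewrite (bigD1 i)//= lerDl sumr_ge0.
Qed.

Lemma l1norm_mulmx p n (B : 'M[R]_(p, n)) :
  exists2 c, 0 < c & forall u, l1norm (B *m u) <= c * l1norm u.
Proof.
exists (1 + \sum_i \sum_j `|B i j|).
  by rewrite ltr_wpDr// sumr_ge0// => i _; exact: sumr_ge0.
move=> u; rewrite mulrDl mul1r ler_wpDl ?l1norm_ge0//.
rewrite mulr_suml; apply: ler_sum => i _.
rewrite mxE (le_trans (ler_norm_sum _ _ _))// mulr_suml.
apply: ler_sum => j _; rewrite normrM ler_wpM2l//.
by rewrite /l1norm (bigD1 j)//= lerDl sumr_ge0.
Qed.

End L1Norm.

Lemma mul_rows_of {R : realType} p n k (I : {set 'I_p}) (B : 'M[R]_(p, n))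
  (u : 'M[R]_(n, k)) : rows_of I B *m u = rows_of I (B *m u).
Proof. exact: mul_rowsub_mx. Qed.

Lemma rows_ofE {R : realType} p n (I : {set 'I_p}) (B : 'M[R]_(p, n)) i j :
  rows_of I B i j = B (enum_val i) j.
Proof. by rewrite mxE. Qed.

(* Moving from [x k] to the active face along the normal component [w] of
   [x k - xs] is feasible near [xs]; the variational inequality then bounds
   [|w|] times the (diverging) sum of the steps by a constant times [|w|]. *)
Section FaceIdentification.
Context {R : realType} {p n : nat}.
Variables (A : 'M[R]_(p, n)) (b : 'cV[R]_p) (x0 xs : 'cV[R]_n).
Variables (a : nat -> R) (g h x : nat -> 'cV[R]_n) (hs : 'cV[R]_n).
Let D := polyhedron A b.
Let y k := x0 - \sum_(i < k) a i *: g i.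
Hypotheses (Dxs : D xs) (Dx : forall k, D (x k)).
Hypothesis VI : forall k t, D t -> dotv (y k - x k) (t - x k) <= 0.
Hypothesis a0 : forall k, 0 <= a k.
Hypothesis a_dvg : ~ cvgn (series a).
Let Aa := rows_of (active A b xs) A.
Variable lambda : 'cV[R]_#|active A b xs|.
Hypothesis lambda0 : forall i, 0 < lambda i 0.
Hypothesis hsE : - hs = Aa^T *m lambda.
Hypothesis noise : forall j, cvgn (series (fun k => a k * (g k j 0 - h k j 0))).
Hypothesis h_cvg : forall j, h k j 0 @[k --> \oo] --> hs j 0.
Hypothesis x_cvg : dotv (x k - xs) (x k - xs) @[k --> \oo] --> 0.

Let X := pseudoinverse Aa.
Let w k := X *m (Aa *m (x k - xs)).
Let S k := l1norm (Aa *m (x k - xs)).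

Let AaX (u : 'cV[R]_n) : Aa *m (X *m (Aa *m u)) = Aa *m u.
Proof. by rewrite !mulmxA; have [->] := pseudoinverseP Aa. Qed.

Let Aa_entry (u : 'cV[R]_n) i : (Aa *m u) i 0 = (A *m u) (enum_val i) 0.
Proof. by rewrite mul_rows_of mxE. Qed.

Let active_val (i : 'I_#|active A b xs|) : (A *m xs) (enum_val i) 0 = b (enum_val i) 0.
Proof. by have := enum_valP i; rewrite inE => /eqP. Qed.

Let Aa_le0 k i : (Aa *m (x k - xs)) i 0 <= 0.
Proof.
rewrite Aa_entry mulmxBr; have := Dx k (enum_val i); rewrite -active_val.
by move: (A *m _) (A *m _) => u v; rewrite !mxE; lra.
Qed.

(** [dotv hs (w k)] is minus the pairing of [lambda] with the residuals [Aa *m (x k - xs)]. The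
    constant is the smallest multiplier, capped at 1. *)
Let normal_drift : exists2 l, 0 < l & forall k, l * S k <= dotv hs (w k).
Proof.
exists (\big[Num.min/1]_i lambda i 0); first by apply/bigmin_gtP.
move=> k; rewrite -[hs]opprK hsE dotvNl dotv_mulmx AaX -sumrN mulr_sumr.
apply: ler_sum => i _; rewrite -mulrN ler0_norm ?Aa_le0//.
by rewrite ler_wpM2r ?oppr_ge0 ?Aa_le0// bigmin_le_cond.
Qed.

(** The vector is [y k - x k] with the accumulated drift [\sum_(i < k) a i *: h i] added back: only
    convergent noise and bounded terms remain. *)
Let bounded_part : exists B, forall k,
  l1norm (x0 - x k - \sum_(i < k) a i *: (g i - h i)) <= B.
Proof.
have cq : cvgn (fun k => dotv (x k - xs) (x k - xs)) by exact: cvgP x_cvg.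
have [Bq qB] := cvgn_bounded cq.
suff /choice[B BP] : forall j, exists B, forall k,
    `|(x0 - x k - \sum_(i < k) a i *: (g i - h i)) j 0| <= B.
  by exists (\sum_j B j) => k; apply: ler_sum => j _; exact: BP.
move=> j; have [Bn nB] := cvgn_bounded (@noise j).
exists (`|x0 j 0 - xs j 0| + (1 + Bq) + Bn) => k.
have -> : (x0 - x k - \sum_(i < k) a i *: (g i - h i)) j 0 =
    (x0 j 0 - xs j 0) - (x k - xs) j 0 - series (fun k => a k * (g k j 0 - h k j 0)) k.
  rewrite !mxE summxE /series /= big_mkord.
  under eq_bigr => i _ do rewrite !mxE.
  by lra.
rewrite (le_trans (ler_normB _ _))// lerD// (le_trans (ler_normB _ _))// lerD//.
have := sqr_entry_le (x k - xs) j; have := le_trans (ler_norm _) (qB k).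
move: (dotv _ _) => q' q1; rewrite -real_normK ?num_real//.
(* This square yields [|t| <= 1 + t ^+ 2], the origin of the constant [1 + Bq]. *)
have := sqr_ge0 (`|(x k - xs) j 0| - 1); nra.
Qed.

(** [x k - w k - xs] is the projection of [x k - xs] on the kernel of [Aa]: the active constraints
    hold with equality, and near [xs] the others keep some slack. *)
Let feasible_shift : \forall k \near \oo, D (x k - w k) /\
  forall i, (A *m xs) i 0 < b i 0 -> (A *m x k) i 0 < b i 0.
Proof.
have [e e0 eP] := inactive_slack A b xs.
have [c c0 cP] := mulmx_bound (1%:M - X *m Aa).
have ec0 : 0 < Num.min e (e / c) by rewrite lt_min e0 divr_gt0.
have small : \forall k \near \oo, dotv (x k - xs) (x k - xs) < Num.min e (e / c).
  exact: (cvgr_lt _ x_cvg).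
apply: filterS small => k.
rewrite lt_min => /andP[qe qec]; split => [i|i xi]; last first.
  have := eP _ qe i xi; rewrite mulmxBr.
  by move: (A *m _) (A *m _) => u v; rewrite !mxE ltr_norml => /andP[]; lra.
have uw : (1%:M - X *m Aa) *m (x k - xs) = x k - w k - xs.
  by rewrite mulmxBl mul1mx -mulmxA addrAC.
have := cP (x k - xs); rewrite uw => uwc.
have uwe : dotv (x k - w k - xs) (x k - w k - xs) < e.
  by rewrite (le_lt_trans uwc)// mulrC -ltr_pdivlMr.
have [xi|] := boolP ((A *m xs) i 0 < b i 0).
  have := eP _ uwe i xi; rewrite mulmxBr.
  by move: (A *m _) (A *m _) => u v; rewrite !mxE ltr_norml => /andP[]; lra.
rewrite -leNgt => xi.
have ia : i \in active A b xs by rewrite inE eq_le xi Dxs.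
have : (Aa *m (x k - w k - xs)) (enum_rank_in ia i) 0 = 0.
  by rewrite addrAC mulmxBr AaX subrr mxE.
rewrite Aa_entry enum_rankK_in// mulmxBr; have := Dxs i.
by move: (A *m _) (A *m _) => u v; rewrite !mxE; lra.
Qed.

Lemma active_face_eventually : \forall k \near \oo, active_face A b xs (x k).
Proof.
have [l l0 lP] := normal_drift; have [B BP] := bounded_part.
have [c c0 cX] := l1norm_mulmx X.
have wS k : l1norm (w k) <= c * S k by exact: cX.
(* From [N1] on, replacing [h i] by its limit costs at most half of the normal drift. *)
have [N1 _ hN1] : \forall k \near \oo, c * l1norm (h k - hs) <= l / 2.
  have eta0 : 0 < l / 2 / c / n.+1%:R by rewrite !divr_gt0.
  have : \forall k \near \oo, forall j, `|hs j 0 - h k j 0| < l / 2 / c / n.+1%:R.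
    by apply: filter_forall => j; have /cvgrPdist_lt/(_ _ eta0) := @h_cvg j.
  apply: filterS => k hk.
  rewrite mulrC -ler_pdivlMr//.
  apply: (@le_trans _ _ (\sum_(j < n) l / 2 / c / n.+1%:R)).
    by apply: ler_sum => j _; rewrite !mxE distrC ltW.
  have lc : 0 < l / 2 / c by rewrite !divr_gt0.
  rewrite sumr_const card_ord -[_ *+ n]mulr_natr -[leLHS]mulrA ler_piMr ?(ltW lc)//.
  by rewrite ler_pdivrMl// mulr1 ler_nat.
(* Cost of the first [N1] vectors [h i], for which only a bound proportional to [S k] is used. *)
pose C2 := \sum_(i < N1) a i * l1norm (h i) * c.
have low k : (N1 <= k)%N ->
    S k * (l / 2 * (series a k - series a N1) - C2) <=
    \sum_(i < k) a i * dotv (h i) (w k).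
  move=> Nk.
  rewrite -(big_mkord xpredT (fun i => a i * dotv (h i) (w k))) (big_cat_nat _ _ (n := N1))//=.
  rewrite mulrBr addrC; apply: lerD; last first.
    rewrite big_mkord -mulrN -sumrN mulr_sumr; apply: ler_sum => i _.
    have := dotv_le_l1 (h i) (w k); rewrite ler_norml => /andP[+ _].
    have := ler_wpM2l (l1norm_ge0 (h i)) (wS k); have := a0 i.
    move: (dotv _ _) (l1norm _) (l1norm (h i)) (S k) => d1 d3 d2 d4 ? ? ?.
    have : a i * (d2 * d3) <= a i * (d2 * (c * d4)) by rewrite ler_wpM2l.
    have : a i * - (d2 * d3) <= a i * d1 by rewrite ler_wpM2l.
    lra.
  rewrite sub_series_geq// mulrA mulr_sumr; apply: ler_sum_nat => i /andP[Ni _].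
  rewrite mulrC ler_wpM2l//.
  have -> : h i = hs + (h i - hs) by rewrite addrC subrK.
  rewrite dotvDl; have := lP k.
  have := dotv_le_l1 (h i - hs) (w k); rewrite ler_norml => /andP[+ _].
  have := ler_wpM2l (l1norm_ge0 (h i - hs)) (wS k).
  have := ler_wpM2r (l1norm_ge0 (Aa *m (x k - xs))) (hN1 i Ni); rewrite -/(S k).
  move: (dotv _ _) (dotv _ _) (l1norm _) (l1norm (h i - hs)) (S k) => d1 d2 d4 d3 d5.
  lra.
have a_inf : series a @ \oo --> +oo.
  by apply: nondecreasing_dvgn_lt => //; apply: nondecreasing_series.
(* Beyond this threshold the accumulated drift exceeds both constants, so that the factor of [S k]
   below is positive. *)
have big : \forall k \near \oo,
    series a N1 + (C2 + B * c) / (l / 2) < series a k.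
  by move/cvgryPgt : a_inf; apply.
have Nn : \forall k \near \oo, (N1 <= k)%N by exists N1.
near=> k.
have [Dt inact] : D (x k - w k) /\
    forall i, (A *m xs) i 0 < b i 0 -> (A *m x k) i 0 < b i 0.
  by near: k; exact: feasible_shift.
have Nk : (N1 <= k)%N by near: k.
have bigk : series a N1 + (C2 + B * c) / (l / 2) < series a k by near: k.
have S0 : S k <= 0.
  (* Tested at the shifted point, the variational inequality reads [0 <= dotv (y k - x k) (w k)]. *)
  have := VI k Dt; rewrite [x k - w k - x k]addrAC subrr add0r dotvNr oppr_le0.
  have -> : y k - x k = (x0 - x k - \sum_(i < k) a i *: (g i - h i)) - \sum_(i < k) a i *: h i.
    rewrite /y; under [in RHS]eq_bigr => i _ do rewrite scalerBr.
    rewrite sumrB; move: (\sum_(i < k) _) (\sum_(i < k) _) => G H.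
    by apply/colP => j; rewrite !mxE; lra.
  rewrite dotvDl dotvNl.
  have -> : dotv (\sum_(i < k) a i *: h i) (w k) = \sum_(i < k) a i * dotv (h i) (w k).
    by rewrite dotv_suml; apply: eq_bigr => i _; rewrite dotvZl.
  move=> VT; have lowk := low k Nk.
  have hV := le_trans (le_trans (ler_norm _) (dotv_le_l1 _ _))
    (ler_pM (l1norm_ge0 _) (l1norm_ge0 _) (BP k) (wS k)).
  have : S k * (l / 2 * (series a k - series a N1) - C2 - B * c) <= 0 by lra.
  rewrite pmulr_lle0//.
  have : (C2 + B * c) / (l / 2) < series a k - series a N1 by lra.
  by rewrite ltr_pdivrMr ?divr_gt0//; lra.
have {}S0 : Aa *m (x k - xs) = 0.
  by apply: l1norm_eq0; apply/eqP; rewrite eq_le S0 l1norm_ge0.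
split.
  move/eqP: S0; rewrite mulmxBr subr_eq0 => /eqP ->.
  by apply/colP => i; rewrite Aa_entry active_val !mxE.
move=> i; rewrite mul_rows_of !rows_ofE; apply: inact.
by have := enum_valP i; rewrite inE.
Unshelve. all: by end_near. Qed.

End FaceIdentification.

(** * Step sizes *)

Section StepSizes.
Context {R : realType} (alpha gamma : R).

(** A discrete integral comparison. With [m = k + 2] it reduces to
    [1 + q / m <= (1 - 1 / m) ^ (- q)], which follows from [1 + x <= exp x] and
    [ln (1 - 1 / m) <= - 1 / m]. *)
Lemma powR_telescope (q : R) (k : nat) : 0 < q ->
  q * k.+2%:R `^ (- (q + 1)) <= k.+1%:R `^ (- q) - k.+2%:R `^ (- q).
Proof.
move=> q0; set m : R := k.+2%:R.
have m0 : 0 < m by [].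
have k0 : 0 < k.+1%:R :> R by [].
have kE : k.+1%:R = m * (1 + - m^-1).
  by rewrite mulrDr mulr1 mulrN divff ?gt_eqF// /m -[in RHS]natr1 addrK.
have m1 : 0 < 1 + - m^-1.
  by rewrite -(pmulr_rgt0 _ m0) -kE.
have -> : m `^ (- (q + 1)) = m `^ (- q) * m^-1.
  by rewrite opprD powRD ?powR_inv1 ?(ltW m0)// (gt_eqF m0) implybT.
rewrite kE powRM ?(ltW m0) ?(ltW m1)//.
have h : 1 + q * m^-1 <= (1 + - m^-1) `^ (- q).
  rewrite /powR gt_eqF//; apply: le_trans (expR_ge1Dx _).
  rewrite lerD2l mulNr -mulrN ler_pM2l// lerNr.
  by apply: le_ln1Dx; rewrite -subr_gt0 opprK addrC.
have := ler_wpM2l (powR_ge0 m (- q)) h.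
move: ((1 + - m^-1) `^ (- q)) (m `^ (- q)) (m^-1) => u1 u2 u3; lra.
Qed.

Lemma cvgn_sqr_step : 2^-1 < gamma ->
  cvgn (series (fun k => step alpha gamma k.+1 ^+ 2)).
Proof.
move=> g2; pose q := 2 * gamma - 1; have q0 : 0 < q by rewrite /q; lra.
have stepE k : step alpha gamma k.+1 ^+ 2 = alpha ^+ 2 * k.+1%:R `^ (- (q + 1)).
  rewrite /step exprMn exprVn; congr (_ * _).
  rewrite -powR_mulrn ?powR_ge0// -powRrM powRN; congr (_ `^ _)^-1.
  by rewrite /q; lra.
(* The first term of the sum is 1; the telescoping inequality bounds the others. *)
pose B k := 1 + q^-1 * (1 - k.+1%:R `^ (- q)).
have bound k : \sum_(i < k.+1) (i.+1%:R : R) `^ (- (q + 1)) <= B k.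
  elim: k => [|k IH].
    by rewrite big_ord_recr big_ord0 /= add0r powR1 /B powR1 subrr mulr0 addr0.
  rewrite big_ord_recr /= -lerBrDr (le_trans IH)// /B.
  have := powR_telescope k q0; rewrite -ler_pdivlMl//.
  move: (_ `^ _) (_ `^ _) (_ `^ _) => u1 u2 u3.
  lra.
apply: (@cvgn_series_eventually_bounded _ _ 1 (alpha ^+ 2 * (1 + q^-1))).
  by move=> k; exact: sqr_ge0.
move=> [//|k] _; rewrite /series /= big_mkord.
under eq_bigr => i _ do rewrite stepE.
rewrite -mulr_sumr ler_wpM2l ?sqr_ge0// (le_trans (bound k))// lerD2l.
by rewrite ler_piMr ?invr_ge0 ?(ltW q0)// gerBl powR_ge0.
Qed.

(** As [gamma < 1], the steps dominate [alpha] times the harmonic sequence. *)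
Lemma dvgn_step : 0 < alpha -> gamma < 1 ->
  ~ cvgn (series (fun k => step alpha gamma k.+1)).
Proof.
move=> a0 g1 cv; apply: (@dvg_harmonic R).
have : cvgn (series (fun k => alpha * harmonic k : R)).
  apply: series_le_cvg cv => k.
  - by rewrite mulr_ge0 ?ltW ?harmonic_gt0.
  - by rewrite divr_ge0 ?powR_ge0 ?ltW.
  - rewrite /harmonic /step ler_wpM2l ?(ltW a0)// lef_pV2 ?posrE ?powR_gt0//.
    by rewrite -[leRHS]powRr1// ler_powR ?ler1n// ltW.
move=> cv'; rewrite (_ : series _ = alpha^-1 *: series (fun k => alpha * harmonic k)).
  exact: is_cvgZl_tmp.
apply/funext => k; rewrite /series /= fctE scaler_sumr; apply: eq_bigr => i _.
by rewrite /GRing.scale /= mulKf// gt_eqF.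
Qed.

End StepSizes.

(** * Change of measure *)

(** [l] is an arbitrary version of the density; the change of variables for the Radon-Nikodym
    derivative is carried over to it by almost everywhere equality. *)
Lemma RN_ge0_integral {R : realType} {d} {T : measurableType d}
    (P Q : probability T R) (l : T -> R) (h : T -> \bar R) :
  P `<< Q ->
  ae_eq Q setT (EFin \o l) ('d (charge_of_finite_measure P) '/d Q) ->
  measurable_fun setT l -> (forall x, 0 <= l x) ->
  measurable_fun setT h -> (forall x, (0 <= h x)%E) ->
  (\int[P]_x h x = \int[Q]_x (h x * (l x)%:E))%E.
Proof.
move=> PQ lE ml l0 mh h0.
rewrite -(Radon_Nikodym_SigmaFinite.change_of_variables PQ h0 measurableT mh).
apply: ge0_ae_eq_integral => //.
- apply: emeasurable_funM => //.
  exact: measurable_int (Radon_Nikodym_SigmaFinite.f_integrable PQ).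
- by apply: emeasurable_funM => //; exact/measurable_EFinP.
- by move=> x _; rewrite mule_ge0// Radon_Nikodym_SigmaFinite.f_ge0.
- by move=> x _; rewrite mule_ge0// lee_fin.
have h2 := ae_eq_Radon_Nikodym_SigmaFinite PQ measurableT.
apply: ae_eqe_mul2l.
exact: ae_eq_trans h2 (ae_eq_sym lE).
Qed.

(** * Gradients and convexity *)

Section DirectionalDerivative.
Context {R : realType} {n : nat}.
Variables (f : 'cV[R]_n -> R) (x v : 'cV[R]_n).
Hypothesis df : differentiable_at f x.

Lemma dotv_gradient : dotv (gradient f x) v = 'D_v (f : 'cV[R]_n -> R^o) x.
Proof.
rewrite deriveE// [in RHS](_ : v = \sum_i v i 0 *: delta_mx i 0); last first.
  rewrite [LHS]matrix_sum_delta; apply: eq_bigr => i _.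
  by rewrite zmodp.big_ord1.
rewrite linear_sum; apply: eq_bigr => i _.
by rewrite linearZ mxE deriveE// mulrC.
Qed.

Lemma difference_quotient (e : R) : 0 < e -> exists2 t, 0 < t <= 1 &
  `|dotv (gradient f x) v - t^-1 * (f (x + t *: v) - f x)| < e.
Proof.
move=> e0; rewrite dotv_gradient.
have /cvgrPdist_lt/(_ _ e0) := diff_derivable (v := v) df.
(* The cap at 1 keeps [x + t *: v] on the segment where increments are controlled. *)
move=> /nbhs_ballP[r /= r0 rP]; exists (Num.min 1 (r / 2)).
  by rewrite lt_min ltr01 divr_gt0//= ge_min lexx.
have t0 : 0 < Num.min 1 (r / 2) by rewrite lt_min ltr01 divr_gt0.
have tr : ball (0 : R) r (Num.min 1 (r / 2)).
  rewrite -ball_normE /= sub0r normrN (gtr0_norm t0).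
  by rewrite gt_min ltr_pdivrMr// ltr_pMr// ltr1n orbT.
by have := rP _ tr (lt0r_neq0 t0); rewrite /= [_ *: v + x]addrC.
Qed.

Lemma dotv_gradient_le (c : R) :
  (forall t, 0 < t <= 1 -> f (x + t *: v) - f x <= t * c) ->
  dotv (gradient f x) v <= c.
Proof.
move=> fc; apply/ler_addgt0Pr => e e0; have [t t01 tP] := difference_quotient e0.
have /andP[t0 _] := t01.
have := fc _ t01; rewrite -ler_pdivrMl//.
by move: tP; rewrite ltr_norml => /andP[]; lra.
Qed.

Lemma dotv_gradient_ge (c : R) :
  (forall t, 0 < t <= 1 -> t * c <= f (x + t *: v) - f x) ->
  c <= dotv (gradient f x) v.
Proof.
move=> fc; apply/ler_addgt0Pr => e e0; have [t t01 tP] := difference_quotient e0.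
have /andP[t0 _] := t01.
have := fc _ t01; rewrite -ler_pdivlMl//.
by move: tP; rewrite ltr_norml => /andP[]; lra.
Qed.

End DirectionalDerivative.

(** Convexity as a bound on increments from [x], ready for difference quotients; convex and
    log-convex functions are both reduced to it. *)
Definition convex_on {R : realType} {n : nat} (D : set 'cV[R]_n) (h : 'cV[R]_n -> R) :=
  forall x y t, D x -> D y -> 0 <= t <= 1 ->
    h (x + t *: (y - x)) - h x <= t * (h y - h x).

Lemma convex_on_gradient {R : realType} {n : nat} (D : set 'cV[R]_n)
    (h : 'cV[R]_n -> R) x y : convex_on D h -> D x -> D y ->
  differentiable_at h x -> dotv (gradient h x) (y - x) <= h y - h x.
Proof.
move=> ch Dx Dy dh; apply: dotv_gradient_le => // t /andP[t0 t1].
by apply: ch => //; rewrite ltW.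
Qed.

Lemma convex_functionW {R : realType} {n : nat} (D : set 'cV[R]_n)
    (h : 'cV[R]_n -> R) : convex_function D h -> convex_on D h.
Proof.
move=> ch x y t Dx Dy /andP[t0 t1].
have zE : x + t *: (y - x) = t *: y + (1 - t) *: x.
  by rewrite scalerBl scale1r scalerBr addrCA.
have hz : h (x + t *: (y - x)) <= t * h y + (1 - t) * h x.
  by rewrite zE; exact: ch (Itv01 t0 t1) y x (mem_set Dy) (mem_set Dx).
by lra.
Qed.

(** The logarithm is concave, so a weighted geometric mean is at most the arithmetic one. An end
    value 0 makes the bound [-oo], which excludes a positive value in between. *)
Lemma log_convexW {R : realType} {n : nat} (D : set 'cV[R]_n)
    (h : 'cV[R]_n -> R) : log_convex D h -> convex_on D h.
Proof.
move=> [h0 lh] x y t Dx Dy /andP[t0 t1].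
have [->|t_0] := eqVneq t 0; first by rewrite scale0r addr0 mul0r subrr.
have [->|t_1] := eqVneq t 1; first by rewrite scale1r mul1r [x + _]addrC subrK.
have t01 : 0 < t < 1 by rewrite !lt_def t_0 t0 eq_sym t_1 t1.
have := lh y x t Dy Dx t01.
have -> : t *: y + (1 - t) *: x = x + t *: (y - x).
  by rewrite scalerBl scale1r scalerBr addrCA.
set z := x + _; have hy := h0 y Dy; have hx := h0 x Dx.
have u0 : 0 <= 1 - t by rewrite subr_ge0.
have [hz|hz] := leP (h z) 0.
  move=> _; have := mulr_ge0 t0 hy; have := mulr_ge0 u0 hx; lra.
rewrite lne_EFin//.
have tpos : 0 < t by case/andP : t01.
have upos : 0 < 1 - t by rewrite subr_gt0; case/andP : t01.
have [hy0|hy0] := leP (h y) 0.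
  by rewrite (le0_lneNy (x := (h y)%:E)) ?lee_fin// gt0_muleNy ?lte_fin.
have [hx0|hx0] := leP (h x) 0.
  rewrite (le0_lneNy (x := (h x)%:E)) ?lee_fin// gt0_muleNy ?lte_fin//.
  by rewrite lne_EFin// -EFinM.
rewrite !lne_EFin// -!EFinM -EFinD lee_fin => le1.
have le2 := concave_ln (Itv01 t0 t1) hy0 hx0.
have := le_trans le1 le2; rewrite ler_ln ?posrE//; last first.
  by rewrite convR_gt0.
rewrite convRE /= /unstable.onem; lra.
Qed.

(** * Measurability of projections, active sets and gradient estimators *)

Section FiniteMeasurability.
Context {R : realType} {d} {T : measurableType d}.

Lemma measurable_forall (I : finType) (E : I -> set T) :
  (forall i, measurable (E i)) -> measurable [set w | forall i, E i w].
Proof.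
move=> mE; rewrite (_ : [set _ | _] = \bigcap_(i in [set` index_enum I]) E i).
  rewrite bigcap_seq.
  by apply: big_ind => [|A B|i _]; [exact: measurableT|exact: measurableI|exact: mE].
by apply/seteqP; split => w /= Ew i => [_|]; apply: Ew => //; exact: mem_index_enum.
Qed.

Lemma measurable_select (I : finType) (c : T -> I) (f : I -> T -> R) :
  (forall i, measurable [set w | c w = i]) ->
  (forall i, measurable_fun setT (f i)) -> measurable_fun setT (fun w => f (c w) w).
Proof.
move=> mc mf.
rewrite (_ : (fun w => _) = fun w => \sum_i \1_[set w | c w = i] w * f i w).
  by apply: measurable_sum => i; apply: measurable_funM => //; exact: measurable_indic.
apply/funext => w; rewrite (bigD1 (c w))//= big1 => [|i ic].
  by rewrite addr0 indicE mem_set// mul1r.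
by rewrite indicE memNset ?mul0r//= => ci; rewrite ci eqxx in ic.
Qed.

End FiniteMeasurability.

Section VectorMeasurability.
Context {R : realType} {d} {T : measurableType d}.

Lemma measurable_vec_entry n (f : T -> 'cV[R]_n) i :
  measurable_fun setT f -> measurable_fun setT (fun w => f w i 0).
Proof.
move=> mf; apply: (measurableT_comp (f := fun u : 'cV[R]_n => u i 0)) => //.
exact: measurable_entry.
Qed.

Lemma measurable_vec n (f : T -> 'cV[R]_n) :
  (forall i, measurable_fun setT (fun w => f w i 0)) -> measurable_fun setT f.
Proof. by move=> mf; apply: measurable_fun_entries => i j; rewrite ord1. Qed.

Lemma measurable_dotv n (f g : T -> 'cV[R]_n) :
  measurable_fun setT f -> measurable_fun setT g ->
  measurable_fun setT (fun w => dotv (f w) (g w)).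
Proof.
move=> mf mg; apply: measurable_sum => i.
by apply: measurable_funM; exact: measurable_vec_entry.
Qed.

Lemma measurable_mulmx p n (B : 'M[R]_(p, n)) (f : T -> 'cV[R]_n) :
  measurable_fun setT f -> measurable_fun setT (fun w => B *m f w).
Proof.
move=> mf; apply: measurable_vec => i.
under eq_fun do rewrite mxE.
apply: measurable_sum => j; apply: measurable_funM => //.
exact: measurable_vec_entry.
Qed.

Lemma measurable_vecZ n (c : T -> R) (f : T -> 'cV[R]_n) :
  measurable_fun setT c -> measurable_fun setT f ->
  measurable_fun setT (fun w => c w *: f w).
Proof.
move=> mc mf; apply: measurable_vec => i; under eq_fun do rewrite mxE.
by apply: measurable_funM => //; exact: measurable_vec_entry.
Qed.

Lemma measurable_vecB n (f g : T -> 'cV[R]_n) :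
  measurable_fun setT f -> measurable_fun setT g ->
  measurable_fun setT (fun w => f w - g w).
Proof.
move=> mf mg; apply: measurable_vec => i; under eq_fun do rewrite !mxE.
by apply: measurable_funB; exact: measurable_vec_entry.
Qed.

Lemma measurable_vec_sum n k (f : nat -> T -> 'cV[R]_n) :
  (forall i, (i < k)%N -> measurable_fun setT (f i)) ->
  measurable_fun setT (fun w => \sum_(i < k) f i w).
Proof.
move=> mf; apply: measurable_vec => j; under eq_fun do rewrite summxE.
by apply: measurable_sum => i; apply: measurable_vec_entry; exact: mf.
Qed.

(** The projection is a nonexpansive function of [y], so [x] inherits measurability from [y] without
    any measurable selection. *)
Lemma measurable_variational n (D : set 'cV[R]_n) (x y : T -> 'cV[R]_n) :
  measurable_fun setT y -> (forall w, D (x w)) ->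
  (forall w t, D t -> dotv (y w - x w) (t - x w) <= 0) -> measurable_fun setT x.
Proof.
move=> my Dx VI; apply: measurable_vec => i.
apply: (measurable_lipschitz (L := n.+1%:R) _ my) => // w w'.
apply: (@le_trans _ _ (enorm (x w - x w'))).
  by have := entry_le_enorm (x w - x w') i; rewrite !mxE.
apply: le_trans (enorm_le_sup _).
exact: projection_lipschitz (Dx w) (Dx w') (VI w) (VI w').
Qed.

Lemma measurable_active p n (A : 'M[R]_(p, n)) b (x : T -> 'cV[R]_n) J :
  measurable_fun setT x -> measurable [set w | active A b (x w) = J].
Proof.
move=> mx.
rewrite (_ : [set _ | _] =
  [set w | forall i, [set w | ((A *m x w) i 0 == b i 0) = (i \in J)] w]).
  apply: measurable_forall => i.
  have : measurable_fun setT (fun w => (A *m x w) i 0 == b i 0).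
    by apply: measurable_fun_eqr => //; apply: measurable_vec_entry; exact: measurable_mulmx.
  move=> /(_ measurableT [set (i \in J)]).
  by rewrite setTI; apply.
apply/seteqP; split => w /=; first by move=> <- i; rewrite inE.
by move=> wJ; apply/setP => i; rewrite inE wJ.
Qed.

End VectorMeasurability.

Lemma measurable_polyhedron {R : realType} p n (A : 'M[R]_(p, n)) b :
  measurable (polyhedron A b).
Proof.
apply: measurable_forall => i.
have : measurable_fun setT (fun x : 'cV[R]_n => (A *m x) i 0).
  by apply: measurable_vec_entry; apply: measurable_mulmx; exact: measurable_id.
move=> /(_ measurableT `]-oo, b i 0]%classic (measurable_itv _)).
by rewrite setTI; congr measurable; apply/seteqP; split => x /=; rewrite in_itv.
Qed.

Section RintegralFacts.
Context {R : realType} {d} {T : measurableType d} (P : probability T R).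

Lemma integrable_fin_sum (I : Type) (s : seq I) (f : I -> T -> R) :
  (forall i, P.-integrable setT (EFin \o f i)) ->
  P.-integrable setT (EFin \o (fun x => \sum_(i <- s) f i x)).
Proof.
move=> fi; have := integrable_sum (mu := P) measurableT s (P := xpredT)
  (h := fun i x => (f i x)%:E) (fun i _ => fi i).
by apply: eq_integrable => // x _ /=; rewrite sumEFin.
Qed.

Lemma Rintegral_sum (I : Type) (s : seq I) (f : I -> T -> R) :
  (forall i, P.-integrable setT (EFin \o f i)) ->
  \int[P]_x (\sum_(i <- s) f i x) = \sum_(i <- s) \int[P]_x f i x.
Proof.
move=> fi; elim: s => [|i s IH].
  rewrite big_nil; under eq_Rintegral => x _ do rewrite big_nil.
  by rewrite /Rintegral integral0.
rewrite big_cons; under eq_Rintegral => x _ do rewrite big_cons.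
by rewrite RintegralD// ?IH//; exact: integrable_fin_sum.
Qed.

Lemma integrable_scaled (c : R) (f : T -> R) : P.-integrable setT (EFin \o f) ->
  P.-integrable setT (EFin \o (fun x => c * f x)).
Proof.
move=> fi; have := integrableZl measurableT c fi.
by apply: eq_integrable.
Qed.

Lemma integrable_diff (f g : T -> R) : P.-integrable setT (EFin \o f) ->
  P.-integrable setT (EFin \o g) ->
  P.-integrable setT (EFin \o (fun x => f x - g x)).
Proof.
move=> fi gi; have := integrableB measurableT fi gi.
by apply: eq_integrable.
Qed.

Lemma integrable_ge0_bound (f : T -> R) (V : R) : measurable_fun setT f ->
  (forall x, 0 <= f x) -> (\int[P]_x (f x)%:E <= V%:E)%E ->
  P.-integrable setT (EFin \o f).
Proof.
move=> mf f0 fV; apply/integrableP; split; first exact/measurable_EFinP.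
under eq_integral => x _ do rewrite /= ger0_norm//.
exact: le_lt_trans fV (ltry _).
Qed.

End RintegralFacts.

Lemma RN_Rintegral {R : realType} {d} {T : measurableType d}
    (P Q : probability T R) (l g : T -> R) :
  P `<< Q ->
  ae_eq Q setT (EFin \o l) ('d (charge_of_finite_measure P) '/d Q) ->
  measurable_fun setT l -> P.-integrable setT (EFin \o g) ->
  \int[Q]_x (l x * g x) = \int[P]_x g x.
Proof.
move=> PQ lE ml gi; rewrite /Rintegral; congr fine.
rewrite -(Radon_Nikodym_change_of_variables PQ measurableT gi).
have mg := measurable_int _ gi.
apply: ae_eq_integral => //.
- by apply/measurable_EFinP; apply: measurable_funM => //; exact/measurable_EFinP.
- by apply: emeasurable_funM => //; exact: measurable_int (Radon_Nikodym_integrable _).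
rewrite (_ : (fun x => _) = (fun x => (g x)%:E * (EFin \o l) x)%E); last first.
  by apply/funext => x; rewrite -EFinM mulrC.
exact: ae_eqe_mul2l.
Qed.

Section JointMeasurability.
Context {R : realType} {s m r p : nat} {d} {T : measurableType d}.
Variables (A : 'M[R]_(p, s)) (b : 'cV[R]_p) (M : set 'cV[R]_m).
Let Theta := polyhedron A b.
Hypothesis mM : measurable M.
Variables (F : 'cV[R]_s -> 'cV[R]_r -> R) (ell : 'cV[R]_r -> 'cV[R]_m -> R).
Hypothesis G_meas : measurable_fun (Theta `*` setT)
  (fun z : 'cV[R]_s * 'cV[R]_r => Ggrad F z.1 z.2).
Hypothesis ell_meas : measurable_fun (setT `*` M)
  (fun z : 'cV[R]_r * 'cV[R]_m => ell z.1 z.2).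
Hypothesis gradell_meas : measurable_fun (setT `*` M)
  (fun z : 'cV[R]_r * 'cV[R]_m => gradient (ell z.1) z.2).
Variables (th : T -> 'cV[R]_s) (nu : T -> 'cV[R]_m).
Hypotheses (mth : measurable_fun setT th) (mnu : measurable_fun setT nu).
Hypotheses (Theta_th : forall w, Theta (th w)) (M_nu : forall w, M (nu w)).

Lemma measurable_joint_grad :
  measurable_fun setT (fun z : T * 'cV[R]_r => Ggrad F (th z.1) z.2).
Proof.
apply: (measurable_comp (F := Theta `*` setT) (g := fun z : T * 'cV[R]_r => (th z.1, z.2))
  (f := fun z : 'cV[R]_s * 'cV[R]_r => Ggrad F z.1 z.2)) => //.
- by apply: measurableX => //; exact: measurable_polyhedron.
- by move=> _ [z _ <-]; split => //=; exact: Theta_th.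
- apply: measurable_fun_pair; last exact: measurable_snd.
  exact: (measurableT_comp mth measurable_fst).
Qed.

Lemma measurable_joint_ell :
  measurable_fun setT (fun z : T * 'cV[R]_r => ell z.2 (nu z.1)).
Proof.
apply: (measurable_comp (F := setT `*` M) (g := fun z : T * 'cV[R]_r => (z.2, nu z.1))
  (f := fun z : 'cV[R]_r * 'cV[R]_m => ell z.1 z.2)) => //.
- exact: measurableX.
- by move=> _ [z _ <-]; split => //=; exact: M_nu.
- apply: measurable_fun_pair; first exact: measurable_snd.
  exact: (measurableT_comp mnu measurable_fst).
Qed.

Lemma measurable_joint_gradell :
  measurable_fun setT (fun z : T * 'cV[R]_r => gradient (ell z.2) (nu z.1)).
Proof.
apply: (measurable_comp (F := setT `*` M) (g := fun z : T * 'cV[R]_r => (z.2, nu z.1))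
  (f := fun z : 'cV[R]_r * 'cV[R]_m => gradient (ell z.1) z.2)) => //.
- exact: measurableX.
- by move=> _ [z _ <-]; split => //=; exact: M_nu.
- apply: measurable_fun_pair; first exact: measurable_snd.
  exact: (measurableT_comp mnu measurable_fst).
Qed.

Lemma measurable_joint_G :
  measurable_fun setT (fun z : T * 'cV[R]_r => G_is F ell (nu z.1) (th z.1) z.2).
Proof.
exact: measurable_vecZ measurable_joint_ell measurable_joint_grad.
Qed.

(** The projector is not continuous in [theta], but it takes finitely many values, one for each
    active set, and each active set is a measurable event. *)
Lemma measurable_joint_proj :
  measurable_fun setT (fun z : T * 'cV[R]_r => proj_grad A b F (th z.1) z.2).
Proof.
apply: measurable_vec => i.
apply: (measurable_select (c := fun z : T * 'cV[R]_r => active A b (th z.1))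
  (f := fun J z => (proj_ker (rows_of J A) *m Ggrad F (th z.1) z.2) i 0)).
- move=> J; apply: measurable_active.
  exact: (measurableT_comp mth measurable_fst).
- move=> J; apply: measurable_vec_entry; apply: measurable_mulmx.
  exact: measurable_joint_grad.
Qed.

Lemma measurable_joint_proj_sqr :
  measurable_fun setT (fun z : T * 'cV[R]_r => enorm (proj_grad A b F (th z.1) z.2) ^+ 2).
Proof.
under eq_fun do rewrite enorm_sqr.
by apply: measurable_dotv; exact: measurable_joint_proj.
Qed.

Lemma measurable_joint_H :
  measurable_fun setT (fun z : T * 'cV[R]_r => H_is A b F ell (th z.1) (nu z.1) z.2).
Proof.
exact: measurable_vecZ measurable_joint_proj_sqr measurable_joint_gradell.
Qed.

End JointMeasurability.

(** * Conditional moments of the gradient estimators *)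

Section ConditionalMoments.
Context {R : realType} {s m r p q : nat}.
Variables (A : 'M[R]_(p, s)) (b : 'cV[R]_p) (C : 'M[R]_(q, m)) (d : 'cV[R]_q).
Let Theta := polyhedron A b.
Let M := polyhedron C d.
Variables (P : probability 'cV[R]_r R) (F : 'cV[R]_s -> 'cV[R]_r -> R).
Hypothesis G_meas : measurable_fun (Theta `*` setT)
  (fun z : 'cV[R]_s * 'cV[R]_r => Ggrad F z.1 z.2).
Hypothesis gradf : forall theta, Theta theta ->
  gradient (objective P F) theta = \col_i \int[P]_x Ggrad F theta x i 0.
Variable Pmu : 'cV[R]_m -> probability 'cV[R]_r R.
Hypothesis P_dom : forall mu, M mu -> P `<< Pmu mu.
Variable ell : 'cV[R]_r -> 'cV[R]_m -> R.
Hypothesis ell_RN : forall mu, M mu ->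
  ae_eq (Pmu mu) setT (fun x => (ell x mu)%:E)
    ('d (charge_of_finite_measure P) '/d (Pmu mu)).
Hypothesis ell_meas : measurable_fun (setT `*` M)
  (fun z : 'cV[R]_r * 'cV[R]_m => ell z.1 z.2).
Hypothesis gradell_meas : measurable_fun (setT `*` M)
  (fun z : 'cV[R]_r * 'cV[R]_m => gradient (ell z.1) z.2).
Hypothesis ell_convex : forall x, log_convex M (ell x).
Hypothesis ell_diff : forall x nu, M nu -> differentiable_at (ell x) nu.
Variables (G_M H_M : R).
Hypothesis G_bound : forall t nu, Theta t -> M nu ->
  (\int[P]_x (enorm (Ggrad F t x) ^+ 2 * ell x nu)%:E <= (G_M ^+ 2)%:E)%E.
Hypothesis H_bound : forall t nu, Theta t -> M nu ->
  (\int[P]_x (enorm (proj_grad A b F t x) ^+ 4 *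
              enorm (gradient (ell x) nu) ^+ 2)%:E <= (H_M ^+ 2)%:E)%E.

Let mM : measurable M. Proof. exact: measurable_polyhedron. Qed.

Section Sections.
Variables (t : 'cV[R]_s) (nu : 'cV[R]_m).
Hypotheses (Tt : Theta t) (Mnu : M nu).

(** A fixed parameter is a random one over [unit], which specializes the joint measurability
    facts. *)
Let tt_pair : measurable_fun setT (fun x : 'cV[R]_r => (tt, x)).
Proof. exact: measurable_fun_pair. Qed.

Let mG : measurable_fun setT (fun x => Ggrad F t x).
Proof.
exact: measurableT_comp (measurable_joint_grad G_meas (th := fun=> t)
  (measurable_cst _) (fun=> Tt)) tt_pair.
Qed.

Let mell : measurable_fun setT (fun x => ell x nu).
Proof.
exact: measurableT_comp (measurable_joint_ell mM ell_meas (nu := fun=> nu)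
  (measurable_cst _) (fun=> Mnu)) tt_pair.
Qed.

Let mgradell : measurable_fun setT (fun x => gradient (ell x) nu).
Proof.
exact: measurableT_comp (measurable_joint_gradell mM gradell_meas (nu := fun=> nu)
  (measurable_cst _) (fun=> Mnu)) tt_pair.
Qed.

Let mproj : measurable_fun setT (fun x => enorm (proj_grad A b F t x) ^+ 2).
Proof.
exact: measurableT_comp (measurable_joint_proj_sqr G_meas (th := fun=> t)
  (measurable_cst _) (fun=> Tt)) tt_pair.
Qed.

Let ell0 x : 0 <= ell x nu. Proof. by have [h _] := ell_convex x; exact: h. Qed.

(** Of the two factors [ell], one turns [Pmu nu] into [P] and the other remains for [G_bound]. *)
Lemma G_second_moment u :
  (\int[Pmu nu]_x (dotv (G_is F ell nu t x) u ^+ 2)%:E <=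
   (dotv u u * G_M ^+ 2)%:E)%E.
Proof.
pose h x := (dotv u u * (enorm (Ggrad F t x) ^+ 2 * ell x nu))%:E.
have mGl : measurable_fun setT (fun x => enorm (Ggrad F t x) ^+ 2 * ell x nu).
  apply: measurable_funM => //; under eq_fun do rewrite enorm_sqr.
  exact: measurable_dotv.
have Gl0 x : 0 <= enorm (Ggrad F t x) ^+ 2 * ell x nu.
  by rewrite mulr_ge0// sqr_ge0.
have mh : measurable_fun setT h.
  by apply/measurable_EFinP; apply: measurable_funM.
have h0 x : (0 <= h x)%E by rewrite lee_fin mulr_ge0// dotvv_ge0.
apply: (@le_trans _ _ (\int[Pmu nu]_x (h x * (ell x nu)%:E))%E).
  apply: ge0_le_integral => //=.
  - by move=> x _; rewrite lee_fin sqr_ge0.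
  - apply/measurable_EFinP; apply: measurable_funX; apply: measurable_dotv => //.
    exact: measurable_vecZ.
  - by apply: emeasurable_funM => //; exact/measurable_EFinP.
  - move=> x _; rewrite -EFinM lee_fin dotvZl exprMn enorm_sqr.
    have -> : dotv u u * (dotv (Ggrad F t x) (Ggrad F t x) * ell x nu) * ell x nu =
      ell x nu ^+ 2 * (dotv (Ggrad F t x) (Ggrad F t x) * dotv u u) by ring.
    by rewrite ler_wpM2l ?sqr_ge0// dotv_sqr_le.
rewrite -(RN_ge0_integral (P_dom Mnu) (ell_RN Mnu))//.
rewrite /h; under eq_integral => x _ do rewrite EFinM.
rewrite ge0_integralZl//; first last.
- by rewrite lee_fin dotvv_ge0.
- by move=> x _; rewrite lee_fin.
- exact/measurable_EFinP.
by rewrite [leRHS]EFinM lee_wpmul2l ?lee_fin ?dotvv_ge0// G_bound.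
Qed.

(** Under [Pmu nu] the weighted gradient is square integrable, hence integrable; the change of
    measure removes the weight. *)
Let int_Gu u : P.-integrable setT (EFin \o (fun x => dotv (Ggrad F t x) u)).
Proof.
have mGu : measurable_fun setT (fun x => dotv (Ggrad F t x) u) by exact: measurable_dotv.
have mGis : measurable_fun setT (fun x => dotv (G_is F ell nu t x) u).
  by apply: measurable_dotv => //; exact: measurable_vecZ.
have := integrable_of_sqr mGis (G_second_moment u).
move=> /integrableP[_]; set I := (X in (X < _)%E) => Ioo.
apply/integrableP; split; first exact/measurable_EFinP.
apply: le_lt_trans Ioo; rewrite (RN_ge0_integral (P_dom Mnu) (ell_RN Mnu))//.
- apply: ge0_le_integral => //=.
  + by move=> x _; rewrite lee_fin mulr_ge0.
  + apply/measurable_EFinP; apply: measurable_funM => //.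
    exact: measurableT_comp.
  + by apply/measurable_EFinP; exact: measurableT_comp.
  + by move=> x _; rewrite lee_fin dotvZl normrM mulrC ler_wpM2r// ler_norm.
- by apply/measurable_EFinP; exact: measurableT_comp.
Qed.

Lemma G_mean u :
  \int[Pmu nu]_x dotv (G_is F ell nu t x) u = dotv (gradient (objective P F) t) u.
Proof.
transitivity (\int[P]_x dotv (Ggrad F t x) u).
  rewrite -(RN_Rintegral (P_dom Mnu) (ell_RN Mnu) mell (int_Gu u)).
  by apply: eq_Rintegral => x _; rewrite dotvZl.
rewrite gradf// /dotv Rintegral_sum; last first.
  move=> i; have := int_Gu (u i 0 *: delta_mx i 0).
  apply: eq_integrable => // x _ /=; congr EFin.
  by rewrite dotvZr dotv_delta mulrC.
apply: eq_bigr => i _; rewrite mxE RintegralZr//.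
have := int_Gu (delta_mx i 0); apply: eq_integrable => // x _ /=; congr EFin.
exact: dotv_delta.
Qed.

Lemma H_second_moment u :
  (\int[P]_x (dotv (H_is A b F ell t nu x) u ^+ 2)%:E <=
   (dotv u u * H_M ^+ 2)%:E)%E.
Proof.
have mH : measurable_fun setT (fun x => enorm (proj_grad A b F t x) ^+ 4 *
              enorm (gradient (ell x) nu) ^+ 2).
  apply: measurable_funM.
    rewrite (_ : (fun x => _) = (fun x => (enorm (proj_grad A b F t x) ^+ 2) ^+ 2)).
      exact: measurable_funX.
    by apply/funext => x; rewrite -exprM.
  by under eq_fun do rewrite enorm_sqr; exact: measurable_dotv.
apply: (@le_trans _ _ (\int[P]_x ((dotv u u)%:E * (enorm (proj_grad A b F t x) ^+ 4 *
              enorm (gradient (ell x) nu) ^+ 2)%:E))%E).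
  apply: ge0_le_integral => //=.
  - by move=> x _; rewrite lee_fin sqr_ge0.
  - apply/measurable_EFinP; apply: measurable_funX; apply: measurable_dotv => //.
    exact: measurable_vecZ.
  - by apply: emeasurable_funM => //; exact/measurable_EFinP.
  - move=> x _; rewrite -EFinM lee_fin dotvZl exprMn -exprM enorm_sqr.
    rewrite [leRHS]mulrCA ler_wpM2l ?exprn_ge0 ?enorm_ge0// mulrC.
    exact: dotv_sqr_le.
rewrite ge0_integralZl//; first last.
- by rewrite lee_fin dotvv_ge0.
- by move=> x _; rewrite lee_fin mulr_ge0 ?exprn_ge0 ?enorm_ge0.
- exact/measurable_EFinP.
by rewrite [leRHS]EFinM lee_wpmul2l ?lee_fin ?dotvv_ge0// H_bound.
Qed.

Lemma integrable_Hu u :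
  P.-integrable setT (EFin \o (fun x => dotv (H_is A b F ell t nu x) u)).
Proof.
apply: integrable_of_sqr (H_second_moment u).
by apply: measurable_dotv => //; exact: measurable_vecZ.
Qed.

Lemma integrable_v :
  P.-integrable setT (EFin \o (fun x => enorm (proj_grad A b F t x) ^+ 2 * ell x nu)).
Proof.
have [c c0 cP] := mulmx_bound (proj_ker (rows_of (active A b t) A)).
have mGl : measurable_fun setT (fun x => enorm (Ggrad F t x) ^+ 2 * ell x nu).
  apply: measurable_funM => //; under eq_fun do rewrite enorm_sqr.
  exact: measurable_dotv.
have Gl0 x : 0 <= enorm (Ggrad F t x) ^+ 2 * ell x nu.
  by rewrite mulr_ge0// sqr_ge0.
have := integrable_scaled c (integrable_ge0_bound mGl Gl0 (G_bound Tt Mnu)).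
apply: le_integrable => //; first by apply/measurable_EFinP; exact: measurable_funM.
move=> x _ /=; rewrite lee_fin [leRHS]ger0_norm; last first.
  by rewrite mulr_ge0 ?(ltW c0).
rewrite ger0_norm; last by rewrite mulr_ge0// sqr_ge0.
by rewrite mulrA ler_wpM2r// !enorm_sqr; exact: cP.
Qed.

End Sections.

Lemma v_is_convex t : Theta t -> convex_on M (v_is A b P F ell t).
Proof.
move=> Tt nu nu' h Mnu Mnu' h01.
have Mh := polyhedron_segment Mnu Mnu' h01.
rewrite /v_is -!RintegralB//; [|exact: integrable_v..].
have i1 := integrable_v Tt Mnu; have i2 := integrable_v Tt Mnu'.
rewrite -RintegralZl//; last exact: integrable_diff.
apply: le_Rintegral => //; first by apply: integrable_diff => //; exact: integrable_v.
  by apply: integrable_scaled; exact: integrable_diff.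
move=> x _; rewrite -!mulrBr mulrCA ler_wpM2l ?sqr_ge0//.
exact: (log_convexW (ell_convex x)).
Qed.

(* Exchanging gradient and integral is avoided: convexity bounds the
   difference quotients of [v] from below by the integral. *)
Lemma H_mean_le t nu nu' : Theta t -> M nu -> M nu' ->
  differentiable_at (v_is A b P F ell t) nu ->
  \int[P]_x dotv (H_is A b F ell t nu x) (nu' - nu) <=
  dotv (gradient (v_is A b P F ell t) nu) (nu' - nu).
Proof.
move=> Tt Mnu Mnu' dv; apply: dotv_gradient_ge => // h /andP[h0 h1].
have h01 : 0 <= h <= 1 by rewrite ltW.
have Mh := polyhedron_segment Mnu Mnu' h01.
have iH := integrable_Hu Tt Mnu (nu' - nu).
rewrite /v_is -RintegralB//; [|exact: integrable_v..].
rewrite -RintegralZl//; apply: le_Rintegral => //.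
- exact: integrable_scaled.
- by apply: integrable_diff; exact: integrable_v.
move=> x _; rewrite dotvZl -mulrBr mulrCA ler_wpM2l ?sqr_ge0//.
rewrite -dotvZr.
have := convex_on_gradient (log_convexW (ell_convex x)) Mnu Mh (ell_diff x Mnu).
by rewrite [_ + h *: _]addrC addrK.
Qed.

End ConditionalMoments.

(** * The iterates as adapted projections, and their noise *)

(** The objective is a function of [theta] plus a function of [mu], over a product set: each block
    minimizes its own part and is therefore a projection. *)
Lemma argmin_split {R : realType} (s m p q : nat)
    (A : 'M[R]_(p, s)) b (C : 'M[R]_(q, m)) d alpha gamma theta0 mu0 g h n x z :
  unique_argmin (polyhedron A b `*` polyhedron C d)
    (dual_averaging_objective alpha gamma theta0 mu0 g h n) (x, z) ->
  [/\ polyhedron A b x, polyhedron C d z,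
    forall t, polyhedron A b t ->
      dotv (theta0 - \sum_(i < n.+1) step alpha gamma i.+1 *: g i - x) (t - x) <= 0 &
    forall t, polyhedron C d t ->
      dotv (mu0 - \sum_(i < n.+1) step alpha gamma i.+1 *: h i - z) (t - z) <= 0].
Proof.
move=> xz; have [[/= Ax Cz] xzmin] : argmin (polyhedron A b `*` polyhedron C d)
    (dual_averaging_objective alpha gamma theta0 mu0 g h n) (x, z) by rewrite xz.
have objE t t' : dual_averaging_objective alpha gamma theta0 mu0 g h n (t, t') =
    (dotv (\sum_(i < n.+1) step alpha gamma i.+1 *: g i) t +
      2^-1 * dotv (t - theta0) (t - theta0)) +
    (dotv (\sum_(i < n.+1) step alpha gamma i.+1 *: h i) t' +
      2^-1 * dotv (t' - mu0) (t' - mu0)).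
  rewrite /dual_averaging_objective /= !enorm_sqr !dotv_suml.
  under eq_bigr => i _ do rewrite mulrDr.
  rewrite big_split /=.
  under [in RHS]eq_bigr => i _ do rewrite dotvZl.
  under [X in _ = _ + (X + _)]eq_bigr => i _ do rewrite dotvZl.
  by lra.
split=> //.
- apply: argmin_variational => // t At.
  by have := xzmin (t, z) (conj At Cz); rewrite !objE; lra.
- apply: argmin_variational => // t Ct.
  by have := xzmin (x, t) (conj Ax Ct); rewrite !objE; lra.
Qed.

Section History.
Context {R : realType} {d d2 : measure_display}.
Context {Omega : measurableType d} {T : measurableType d2}.
Variables Y X : nat -> Omega -> T.
Hypothesis Y_meas : forall k, measurable_fun setT (Y k.+1).
Hypothesis X_meas : forall k, measurable_fun setT (X k.+1).

(** The generator of [history], named so that [g_sigma_algebraType] makes [Omega] a measurable type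
    for each time. *)
Definition history_gen (n : nat) : set (set Omega) :=
  [set E | exists (k : nat) (B : set T), [/\ (1 <= k <= n)%N, measurable B &
         E = Y k @^-1` B \/ E = X k @^-1` B]].

Lemma history_measurable n E : <<s history_gen n >> E -> measurable E.
Proof.
apply: smallest_sub; first exact: sigma_algebra_measurable.
move=> E0 [[|k] [B [// _ mB [->|->]]]]; rewrite -[X in measurable X]setTI.
- by apply: (@Y_meas k).
- by apply: (@X_meas k).
Qed.

Lemma history_le n n' E : (n <= n')%N ->
  <<s history_gen n >> E -> <<s history_gen n' >> E.
Proof.
move=> nn'; apply: sub_sigma_algebra2 => {}E [k [B [/andP[k1 kn] mB EB]]].
by exists k, B; split => //; rewrite k1 (leq_trans kn).
Qed.

Notation Hist n := (g_sigma_algebraType (history_gen n)).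

Lemma measurable_history_le n n' {d3} {U : measurableType d3} (f : Omega -> U) :
  (n <= n')%N -> @measurable_fun _ _ (Hist n) U setT f ->
  @measurable_fun _ _ (Hist n') U setT f.
Proof.
move=> nn' mf _ B mB; rewrite setTI; apply: history_le nn' _.
by have := mf measurableT B mB; rewrite setTI.
Qed.

Lemma measurable_history_Y n : @measurable_fun _ _ (Hist n.+1) T setT (Y n.+1).
Proof.
move=> _ B mB; rewrite setTI; apply: sub_sigma_algebra.
by exists n.+1, B; split; [rewrite /= leqnn|exact: mB|left].
Qed.

Lemma measurable_history_X n : @measurable_fun _ _ (Hist n.+1) T setT (X n.+1).
Proof.
move=> _ B mB; rewrite setTI; apply: sub_sigma_algebra.
by exists n.+1, B; split; [rewrite /= leqnn|exact: mB|right].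
Qed.

Lemma measurable_history_joint n {d3} {U : measurableType d3}
    (Z : Omega -> T) (f : Omega * T -> U) :
  @measurable_fun _ _ (Hist n.+1) T setT Z ->
  @measurable_fun _ _ (Hist n * T)%type U setT f ->
  @measurable_fun _ _ (Hist n.+1) U setT (fun w => f (w, Z w)).
Proof.
move=> mZ mf; apply: (measurableT_comp (f := f : Hist n * T -> U)); first exact: mf.
apply: measurable_fun_pair; last exact: mZ.
by apply: measurable_history_le (leqnSn n) _; exact: measurable_id.
Qed.

End History.

Section Process.
Context {R : realType} {s m r p q : nat}.
Variables (A : 'M[R]_(p, s)) (b : 'cV[R]_p) (C : 'M[R]_(q, m)) (d : 'cV[R]_q).
Let Theta := polyhedron A b.
Let M := polyhedron C d.
Variables (P : probability 'cV[R]_r R) (F : 'cV[R]_s -> 'cV[R]_r -> R).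
Hypothesis G_meas : measurable_fun (Theta `*` setT)
  (fun z : 'cV[R]_s * 'cV[R]_r => Ggrad F z.1 z.2).
Hypothesis gradf : forall theta, Theta theta ->
  gradient (objective P F) theta = \col_i \int[P]_x Ggrad F theta x i 0.
Variable Pmu : 'cV[R]_m -> probability 'cV[R]_r R.
Hypothesis P_dom : forall mu, M mu -> P `<< Pmu mu.
Variable ell : 'cV[R]_r -> 'cV[R]_m -> R.
Hypothesis ell_RN : forall mu, M mu ->
  ae_eq (Pmu mu) setT (fun x => (ell x mu)%:E)
    ('d (charge_of_finite_measure P) '/d (Pmu mu)).
Hypothesis ell_meas : measurable_fun (setT `*` M)
  (fun z : 'cV[R]_r * 'cV[R]_m => ell z.1 z.2).
Hypothesis gradell_meas : measurable_fun (setT `*` M)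
  (fun z : 'cV[R]_r * 'cV[R]_m => gradient (ell z.1) z.2).
Hypothesis ell_convex : forall x, log_convex M (ell x).
Variables (G_M H_M : R).
Hypothesis G_bound : forall t nu, Theta t -> M nu ->
  (\int[P]_x (enorm (Ggrad F t x) ^+ 2 * ell x nu)%:E <= (G_M ^+ 2)%:E)%E.
Hypothesis H_bound : forall t nu, Theta t -> M nu ->
  (\int[P]_x (enorm (proj_grad A b F t x) ^+ 4 *
              enorm (gradient (ell x) nu) ^+ 2)%:E <= (H_M ^+ 2)%:E)%E.
Variables (alpha gamma : R) (theta0 : 'cV[R]_s) (mu0 : 'cV[R]_m).
Hypotheses (Theta0 : Theta theta0) (M0 : M mu0).
Context {dO : measure_display} {Omega : measurableType dO}.
Variables (Pr : probability Omega R) (Y X : nat -> Omega -> 'cV[R]_r).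
Hypothesis Y_meas : forall k, measurable_fun setT (Y k.+1).
Hypothesis X_meas : forall k, measurable_fun setT (X k.+1).
Variables (theta : nat -> Omega -> 'cV[R]_s) (mu : nat -> Omega -> 'cV[R]_m).
Hypothesis theta_init : forall w, theta 0%N w = theta0.
Hypothesis mu_init : forall w, mu 0%N w = mu0.
Let Gk k w := G_is F ell (mu k w) (theta k w) (Y k.+1 w).
Let Hk k w := H_is A b F ell (theta k w) (mu k w) (X k.+1 w).
Hypothesis iterates : forall n w,
  unique_argmin (Theta `*` M)
    (dual_averaging_objective alpha gamma theta0 mu0 (Gk ^~ w) (Hk ^~ w) n)
    (theta n.+1 w, mu n.+1 w).
Hypothesis draws : forall k,
  cond_indep_laws Pr (history Y X k)
    (Y k.+1) (fun w => Pmu (mu k w)) (X k.+1) (fun=> P).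
Let a k := step alpha gamma k.+1.
Notation Hist n := (g_sigma_algebraType (history_gen Y X n)).

Lemma theta_in n w : Theta (theta n w).
Proof.
case: n => [|n]; first by rewrite theta_init.
by have [] := argmin_split (iterates n w).
Qed.

Lemma mu_in n w : M (mu n w).
Proof.
case: n => [|n]; first by rewrite mu_init.
by have [] := argmin_split (iterates n w).
Qed.

Lemma theta_variational n w t : Theta t ->
  dotv (theta0 - \sum_(i < n) a i *: Gk i w - theta n w) (t - theta n w) <= 0.
Proof.
(* At time 0 the sum is empty and the starting point is its own projection. *)
case: n => [|n] Tt; last by have [_ _ h _] := argmin_split (iterates n w); exact: h.
by rewrite big_ord0 subr0 theta_init subrr dotv0l.
Qed.

Lemma mu_variational n w t : M t ->
  dotv (mu0 - \sum_(i < n) a i *: Hk i w - mu n w) (t - mu n w) <= 0.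
Proof.
case: n => [|n] Mt; last by have [_ _ _ h] := argmin_split (iterates n w); exact: h.
by rewrite big_ord0 subr0 mu_init subrr dotv0l.
Qed.

Lemma measurable_iterates n :
  @measurable_fun _ _ (Hist n) _ setT (theta n) /\
  @measurable_fun _ _ (Hist n) _ setT (mu n).
Proof.
have mM : measurable M by exact: measurable_polyhedron.
(* All earlier iterates enter the sum, hence the strong induction; the draws used at step [i < n]
   are known at time [i.+1 <= n]. *)
elim/ltn_ind: n => n IH.
split.
- apply: (measurable_variational (D := Theta)
    (y := fun w : Hist n => theta0 - \sum_(i < n) a i *: Gk i w)).
  + apply: measurable_vecB; first exact: measurable_cst.
    apply: (measurable_vec_sum (T := Hist n) (f := fun i w => a i *: Gk i w)) => i ni; have [mt mm] := IH i ni.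
    apply: measurable_vecZ; first exact: measurable_cst.
    apply: measurable_history_le ni _.
    apply: (measurable_history_joint (f := fun z => G_is F ell (mu i z.1) (theta i z.1) z.2)).
      exact: measurable_history_Y.
    exact: (measurable_joint_G mM G_meas ell_meas mt mm (theta_in i) (mu_in i)).
  + by move=> w; exact: theta_in.
  + by move=> w t Tt; exact: theta_variational.
- apply: (measurable_variational (D := M)
    (y := fun w : Hist n => mu0 - \sum_(i < n) a i *: Hk i w)).
  + apply: measurable_vecB; first exact: measurable_cst.
    apply: (measurable_vec_sum (T := Hist n) (f := fun i w => a i *: Hk i w)) => i ni; have [mt mm] := IH i ni.
    apply: measurable_vecZ; first exact: measurable_cst.
    apply: measurable_history_le ni _.
    apply: (measurable_history_joint (f := fun z => H_is A b F ell (theta i z.1) (mu i z.1) z.2)).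
      exact: measurable_history_X.
    exact: (measurable_joint_H mM G_meas gradell_meas mt mm (theta_in i) (mu_in i)).
  + by move=> w; exact: mu_in.
  + by move=> w t Mt; exact: mu_variational.
Qed.

Hypothesis a2 : cvgn (series (fun k => a k ^+ 2)).

(** Unbiasedness, [G_mean], replaces the kernel mean by the gradient of the objective; the
    conditional second moments are at most [B * G_M ^+ 2]. *)
Lemma G_noise (u : nat -> Omega -> 'cV[R]_s) (B : R) :
  (forall k, @measurable_fun _ _ (Hist k) _ setT (u k)) ->
  (forall k w, dotv (u k w) (u k w) <= B) ->
  {ae Pr, forall w,
    cvgn (series (fun k => a k * (dotv (Gk k w) (u k w) -
                                  dotv (gradient (objective P F) (theta k w)) (u k w)))) /\
    cvgn (series (fun k => a k ^+ 2 * dotv (Gk k w) (u k w) ^+ 2))}.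
Proof.
move=> mu_ uB.
pose g k (z : Omega * 'cV[R]_r) := dotv (G_is F ell (mu k z.1) (theta k z.1) z.2) (u k z.1).
have mg k : @measurable_fun _ _ (Hist k * 'cV[R]_r)%type R setT (g k).
  have [mt mm] := measurable_iterates k.
  apply: measurable_dotv; last exact: (measurableT_comp (mu_ k) measurable_fst).
  exact: (measurable_joint_G (measurable_polyhedron _ _) G_meas ell_meas mt mm (theta_in k) (mu_in k)).
have gV k w : (\int[Pmu (mu k w)]_x (g k (w, x) ^+ 2)%:E <= (B * G_M ^+ 2)%:E)%E.
  apply: le_trans (G_second_moment G_meas P_dom ell_RN ell_meas ell_convex G_bound
    (theta_in k w) (mu_in k w) (u k w)) _.
  by rewrite lee_fin ler_wpM2r ?sqr_ge0.
have ZK k : is_cond_law Pr <<s history_gen Y X k >> (Y k.+1) (fun w => Pmu (mu k w)).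
  by have [] := draws k.
have sub := history_measurable Y_meas X_meas.
have mono k E := @history_le _ _ _ _ Y X k k.+1 E (leqnSn k).
have n1 := noise_cvg sub mono (@measurable_history_Y _ _ _ _ Y X) ZK mg gV a2.
have n2 := cvg_sqr_series sub mono (@measurable_history_Y _ _ _ _ Y X) ZK mg gV a2.
apply: filterS2 n1 n2 => w c1 c2; split => //.
rewrite (_ : (fun k => _) = (fun k => a k * (g k (w, Y k.+1 w) -
  \int[Pmu (mu k w)]_x g k (w, x)))) //; apply/funext => k.
by rewrite -(G_mean G_meas gradf P_dom ell_RN ell_meas ell_convex G_bound (theta_in k w) (mu_in k w)).
Qed.

(** The mean is left as an integral, since it is related to the gradient of [v] only by the
    one-sided bound [H_mean_le]. *)
Lemma H_noise (u : nat -> Omega -> 'cV[R]_m) (B : R) :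
  (forall k, @measurable_fun _ _ (Hist k) _ setT (u k)) ->
  (forall k w, dotv (u k w) (u k w) <= B) ->
  {ae Pr, forall w,
    cvgn (series (fun k => a k * (dotv (Hk k w) (u k w) -
       \int[P]_x dotv (H_is A b F ell (theta k w) (mu k w) x) (u k w)))) /\
    cvgn (series (fun k => a k ^+ 2 * dotv (Hk k w) (u k w) ^+ 2))}.
Proof.
move=> mu_ uB.
pose g k (z : Omega * 'cV[R]_r) := dotv (H_is A b F ell (theta k z.1) (mu k z.1) z.2) (u k z.1).
have mg k : @measurable_fun _ _ (Hist k * 'cV[R]_r)%type R setT (g k).
  have [mt mm] := measurable_iterates k.
  apply: measurable_dotv; last exact: (measurableT_comp (mu_ k) measurable_fst).
  exact: (measurable_joint_H (measurable_polyhedron _ _) G_meas gradell_meas mt mm (theta_in k) (mu_in k)).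
have gV k w : (\int[P]_x (g k (w, x) ^+ 2)%:E <= (B * H_M ^+ 2)%:E)%E.
  apply: le_trans (H_second_moment G_meas gradell_meas H_bound
    (theta_in k w) (mu_in k w) (u k w)) _.
  by rewrite lee_fin ler_wpM2r ?sqr_ge0.
have ZK k : is_cond_law Pr <<s history_gen Y X k >> (X k.+1) (fun=> P).
  by have [] := draws k.
have sub := history_measurable Y_meas X_meas.
have mono k E := @history_le _ _ _ _ Y X k k.+1 E (leqnSn k).
have n1 := noise_cvg sub mono (@measurable_history_X _ _ _ _ Y X) ZK mg gV a2.
have n2 := cvg_sqr_series sub mono (@measurable_history_X _ _ _ _ Y X) ZK mg gV a2.
by apply: filterS2 n1 n2 => w c1 c2; split.
Qed.

End Process.

(** * Pathwise facts and conclusion *)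

Section PathwiseFacts.
Context {R : realType}.

Lemma bounded_dotv n (D : set 'cV[R]_n) (xs : 'cV[R]_n) : bounded_set D ->
  exists B, forall t, D t -> dotv (t - xs) (t - xs) <= B.
Proof.
move=> [N [_ /(_ (N + 1))]]; rewrite ltrDl ltr01 => /(_ isT) DN.
exists ((n.+1%:R * (N + 1 + `|xs|)) ^+ 2) => t /DN tN.
rewrite -enorm_sqr lerXn2r ?nnegrE ?enorm_ge0//.
  by rewrite mulr_ge0// addr_ge0// (le_trans (normr_ge0 t)).
rewrite (le_trans (enorm_le_sup _))// ler_wpM2l//.
by rewrite (le_trans (ler_normB _ _))// lerD2r.
Qed.

Lemma cvgn_series_finsum (I : finType) (f : I -> R^nat) :
  (forall i, cvgn (series (f i))) -> cvgn (series (fun k => \sum_i f i k)).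
Proof.
move=> cf; elim: (index_enum I) => [|i l IH].
  rewrite (_ : series _ = cst 0); first exact: is_cvg_cst.
  by apply/funext => k; rewrite /series /= big1// => j _; rewrite big_nil.
rewrite (_ : series _ = series (f i) + series (fun k => \sum_(i <- l) f i k)).
  exact: is_cvgD.
apply/funext => k; rewrite fctE /series /= -big_split /=.
by apply: eq_bigr => j _; rewrite big_cons.
Qed.

Lemma cvgn_seriesZ (c : R) (u : R^nat) :
  cvgn (series u) -> cvgn (series (fun k => c * u k)).
Proof.
move=> cu; rewrite (_ : (fun k => c * u k) = c *: u)// seriesZ.
exact: is_cvgZl_tmp.
Qed.

Lemma entry_dist_le_enorm n (u v : 'cV[R]_n) i :
  `|v i 0 - u i 0| <= enorm (u - v).
Proof. by rewrite distrC; have := entry_le_enorm (u - v) i; rewrite !mxE. Qed.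

Lemma enorm_cvg n (x : nat -> 'cV[R]_n) (xs : 'cV[R]_n) :
  dotv (x k - xs) (x k - xs) @[k --> \oo] --> (0 : R) ->
  enorm (x k - xs) @[k --> \oo] --> (0 : R).
Proof.
move=> q0; rewrite /enorm -[X in _ --> X]sqrtr0.
exact: (cvg_comp _ _ q0 (@sqrt_continuous R 0)).
Qed.

Lemma vec_cvg n (x : nat -> 'cV[R]_n) (xs : 'cV[R]_n) :
  dotv (x k - xs) (x k - xs) @[k --> \oo] --> (0 : R) -> x k @[k --> \oo] --> xs.
Proof.
move=> /enorm_cvg e0; apply/cvgrPdist_lt => e egt0.
have small : \forall k \near \oo, enorm (x k - xs) < e by exact: (cvgr_lt _ e0).
apply: filterS small => k ke; rewrite distrC.
exact: le_lt_trans (sup_le_enorm _) ke.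
Qed.

Lemma active_face_self p n (A : 'M[R]_(p, n)) b x : active_face A b x x.
Proof.
split.
  apply/colP => i; rewrite mul_rows_of !rows_ofE.
  by have := enum_valP i; rewrite inE => /eqP.
by move=> i; rewrite mul_rows_of !rows_ofE; have := enum_valP i; rewrite inE.
Qed.

(** Here [gs] is the gradient of [v(theta*, .)] at [w], [gt] the one for the current [theta], and
    [I] the mean of [H] in the direction [v - w]. Growth and convexity give the drift for [gs]; by
    Cauchy-Schwarz passing to [gt] costs at most [e * E]. *)
Lemma perturbed_drift n (gt gs v w : 'cV[R]_n) (I c e E fv fw : R) :
  I <= dotv gt (v - w) -> dotv gs (v - w) <= fv - fw ->
  c * enorm (w - v) ^+ 2 <= fw - fv -> enorm (gt - gs) <= e -> enorm (w - v) <= E ->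
  c * dotv (w - v) (w - v) - e * E <= -1 * I.
Proof.
rewrite -(opprB w v) enorm_sqr; move: (w - v) => u h1 h2 h3 h4 h5.
have := dotv_le (gt - gs) u; rewrite ler_norml => /andP[+ _].
have := ler_pM (enorm_ge0 _) (enorm_ge0 _) h4 h5.
by move: h1 h2; rewrite !dotvNr dotvDl dotvNl; lra.
Qed.

End PathwiseFacts.

Theorem theorem5p2 (R : realType) (s m r p q : nat)
  (* constraint sets *)
  (A : 'M[R]_(p, s)) (b : 'cV[R]_p) (C : 'M[R]_(q, m)) (d : 'cV[R]_q)
  (Theta : set 'cV[R]_s) (Theta_def : Theta = polyhedron A b)
  (M : set 'cV[R]_m) (M_def : M = polyhedron C d)
  (* target distribution, integrand and its gradient *)
  (calX : set 'cV[R]_r) (calX_meas : measurable calX)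
  (P : probability 'cV[R]_r R) (P_calX : P calX = 1%E)
  (F : 'cV[R]_s -> 'cV[R]_r -> R)
  (F_diff : forall theta x, Theta theta -> calX x ->
     differentiable_at (fun t => F t x) theta)
  (F_int : forall theta, Theta theta ->
     P.-integrable setT (EFin \o F theta))
  (G_meas : measurable_fun (Theta `*` setT)
     (fun z : 'cV[R]_s * 'cV[R]_r => Ggrad F z.1 z.2))
  (gradf : forall theta, Theta theta ->
     gradient (objective P F) theta = \col_i \int[P]_x Ggrad F theta x i 0)
  (* importance sampling family and likelihood ratio *)
  (Pmu : 'cV[R]_m -> probability 'cV[R]_r R)
  (P_dom : forall mu, M mu -> P `<< Pmu mu)
  (ell : 'cV[R]_r -> 'cV[R]_m -> R)
  (ell_RN : forall mu, M mu ->
     ae_eq (Pmu mu) setT (fun x => (ell x mu)%:E)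
       ('d (charge_of_finite_measure P) '/d (Pmu mu)))
  (ell_meas : measurable_fun (setT `*` M)
     (fun z : 'cV[R]_r * 'cV[R]_m => ell z.1 z.2))
  (gradell_meas : measurable_fun (setT `*` M)
     (fun z : 'cV[R]_r * 'cV[R]_m => gradient (ell z.1) z.2))
  (* step sizes and initialization *)
  (alpha gamma : R) (alpha_gt0 : 0 < alpha)
  (gamma_gt : 2^-1 < gamma) (gamma_lt1 : gamma < 1)
  (theta0 : 'cV[R]_s) (mu0 : 'cV[R]_m) (Theta0 : Theta theta0) (M0 : M mu0)
  (* the algorithm: Y k is the draw from P_{mu_{k-1}}, X k the draw from P *)
  (dO : measure_display) (Omega : measurableType dO) (Pr : probability Omega R)
  (Y X : nat -> Omega -> 'cV[R]_r)
  (Y_meas : forall k, measurable_fun setT (Y k.+1))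
  (X_meas : forall k, measurable_fun setT (X k.+1))
  (theta : nat -> Omega -> 'cV[R]_s) (mu : nat -> Omega -> 'cV[R]_m)
  (theta_init : forall w, theta 0%N w = theta0)
  (mu_init : forall w, mu 0%N w = mu0)
  (iterates : forall n w,
     unique_argmin (Theta `*` M)
       (dual_averaging_objective alpha gamma theta0 mu0
          (fun k => G_is F ell (mu k w) (theta k w) (Y k.+1 w))
          (fun k => H_is A b F ell (theta k w) (mu k w) (X k.+1 w)) n)
       (theta n.+1 w, mu n.+1 w))
  (draws : forall k,
     cond_indep_laws Pr (history Y X k)
       (Y k.+1) (fun w => Pmu (mu k w)) (X k.+1) (fun=> P))
  (* (a) *)
  (thetastar : 'cV[R]_s)
  (f_convex : convex_function Theta (objective P F))
  (f_C1 : C1_on Theta (objective P F))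
  (F_int_near : \forall t \near thetastar,
     P.-integrable setT (EFin \o F t))
  (f_C2 : C2_near (objective P F) thetastar)
  (thetastar_min : unique_argmin Theta (objective P F) thetastar)
  (f_posdef : posdef (hessian (objective P F) thetastar))
  (Theta_bounded : bounded_set Theta)
  (* (b) *)
  (ell_convex : forall x, log_convex M (ell x))
  (ell_diff : forall x nu, M nu -> differentiable_at (ell x) nu)
  (* (c) *)
  (mustar : 'cV[R]_m)
  (mustar_min : unique_argmin M (v_is A b P F ell thetastar) mustar)
  (v_diff : forall t nu, Theta t -> active_face A b thetastar t -> M nu ->
     differentiable_at (v_is A b P F ell t) nu)
  (v_diff2 : twice_differentiable_at (v_is A b P F ell thetastar) mustar)
  (v_posdef : posdef (hessian (v_is A b P F ell thetastar) mustar))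
  (M_bounded : bounded_set M)
  (G_M H_M : R)
  (G_bound : forall t nu, Theta t -> M nu ->
     (\int[P]_x (enorm (Ggrad F t x) ^+ 2 * ell x nu)%:E <= (G_M ^+ 2)%:E)%E)
  (H_bound : forall t nu, Theta t -> M nu ->
     (\int[P]_x (enorm (proj_grad A b F t x) ^+ 4 *
                 enorm (gradient (ell x) nu) ^+ 2)%:E <= (H_M ^+ 2)%:E)%E)
  (* (d) *)
  (c1 c2 c3 : R) (c1_gt0 : 0 < c1)
  (f_growth : forall t, Theta t ->
     c1 * enorm (t - thetastar) ^+ 2
       <= objective P F t - objective P F thetastar)
  (v_growth : forall nu, M nu ->
     c1 * enorm (nu - mustar) ^+ 2
       <= v_is A b P F ell thetastar nu - v_is A b P F ell thetastar mustar)
  (gradf_lip : forall t, Theta t ->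
     enorm (gradient (objective P F) t - gradient (objective P F) thetastar)
       <= c2 * enorm (t - thetastar))
  (gradv_lip : forall nu, M nu ->
     enorm (gradient (v_is A b P F ell thetastar) nu
            - gradient (v_is A b P F ell thetastar) mustar)
       <= c2 * enorm (nu - mustar))
  (gradv_theta : forall t nu, Theta t -> active_face A b thetastar t -> M nu ->
     enorm (gradient (v_is A b P F ell t) nu
            - gradient (v_is A b P F ell thetastar) nu)
       <= c3 * enorm (t - thetastar) ^+ 2)
  (strict_compl : exists2 lambda : 'cV[R]_#|active A b thetastar|,
     (forall i, 0 < lambda i 0) &
     - gradient (objective P F) thetastar
       = (rows_of (active A b thetastar) A)^T *m lambda) :
  {ae Pr, forall w,
     (theta n w, mu n w) @[n --> \oo] --> (thetastar, mustar)}.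

Proof.
subst Theta M.
have [[Tts ts_min] [Mms ms_min]] :
    argmin (polyhedron A b) (objective P F) thetastar /\
    argmin (polyhedron C d) (v_is A b P F ell thetastar) mustar.
  by split; [rewrite thetastar_min|rewrite mustar_min].
pose a k := step alpha gamma k.+1.
have a0 k : 0 <= a k by rewrite divr_ge0 ?powR_ge0// ltW.
have a2 : cvgn (series (fun k => a k ^+ 2)) by exact: cvgn_sqr_step.
have a_dvg : ~ cvgn (series a) by exact: dvgn_step.
have [Bt tB] := bounded_dotv thetastar Theta_bounded.
have [Bm mB] := bounded_dotv mustar M_bounded.
have th_in := theta_in Theta0 theta_init iterates.
have mu_in := mu_in M0 mu_init iterates.
have meas := measurable_iterates G_meas ell_meas gradell_meas
  Theta0 M0 theta_init mu_init iterates.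
have Gn := G_noise G_meas gradf P_dom ell_RN ell_meas gradell_meas ell_convex
  G_bound Theta0 M0 Y_meas X_meas theta_init mu_init iterates draws a2.
have Hn := H_noise G_meas ell_meas gradell_meas
  H_bound Theta0 M0 Y_meas X_meas theta_init mu_init iterates draws a2.
have dd n (i : 'I_n) : dotv (delta_mx i 0 : 'cV[R]_n) (delta_mx i 0) <= 1.
  by rewrite dotv_delta mxE !eqxx.
have G1 := Gn (fun k w => theta k w - thetastar) Bt
  (fun k => measurable_vecB (meas k).1 (measurable_cst _)) (fun k w => tB _ (th_in k w)).
have H1 := Hn (fun k w => mu k w - mustar) Bm
  (fun k => measurable_vecB (meas k).2 (measurable_cst _)) (fun k w => mB _ (mu_in k w)).
have aeF : Filter (almost_everywhere Pr) by exact: ae_filter_ringOfSetsType.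
have G2 := filter_forall aeF (fun i => Gn (fun _ _ => delta_mx i 0) 1
  (fun k => measurable_cst _) (fun _ _ => dd _ i)).
have H2 := filter_forall aeF (fun i => Hn (fun _ _ => delta_mx i 0) 1
  (fun k => measurable_cst _) (fun _ _ => dd _ i)).
apply: filterS2 (filterI G1 G2) (filterI H1 H2) => w [[gn _] g2] [[hn _] h2].
have f_cvx := convex_functionW f_convex.
have sqE n (g : nat -> 'cV[R]_n) :
    (forall i, cvgn (series (fun k => a k ^+ 2 * dotv (g k) (delta_mx i 0) ^+ 2))) ->
    cvgn (series (fun k => a k ^+ 2 * dotv (g k) (g k))).
  move=> /cvgn_series_finsum cg.
  rewrite (_ : (fun k => _) =
    (fun k => \sum_i a k ^+ 2 * dotv (g k) (delta_mx i 0) ^+ 2))//.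
  apply/funext => k; rewrite -mulr_sumr; congr (_ * _); apply: eq_bigr => i _.
  by rewrite dotv_delta -expr2.
pose qt k := dotv (theta k w - thetastar) (theta k w - thetastar).
have [sum_q q0] : cvgn (series (fun k => a k * qt k)) /\ qt k @[k --> \oo] --> 0.
  (* For [theta] the drift holds from the start and without error, so [N] and [e] are zero. *)
  apply: (dual_averaging_cvg Tts (th_in ^~ w)
    (fun k => theta_variational theta_init iterates k w) a0 a_dvg c1_gt0 gn
    (sqE _ _ (fun i => (g2 i).2)) (N := 0%N) (e := fun=> 0)) => [k _|].
    have := convex_on_gradient f_cvx (th_in k w) Tts (f_C1.1 _ (th_in k w)).
    have := f_growth _ (th_in k w); rewrite enorm_sqr subr0.
    by rewrite -(opprB (theta k w)) dotvNr; lra.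
  rewrite (_ : series _ = cst 0); first exact: is_cvg_cst.
  by apply/funext => k; rewrite /series /= big1// => i _; rewrite mulr0.
have thc := vec_cvg q0.
have [lambda lambda0 lambdaE] := strict_compl.
have [N _ faceN] : \forall k \near \oo, active_face A b thetastar (theta k w).
  apply: (active_face_eventually (x0 := theta0) (a := a)
    (g := fun k => G_is F ell (mu k w) (theta k w) (Y k.+1 w))
    (h := fun k => gradient (objective P F) (theta k w))
    Tts (th_in ^~ w) (fun k => theta_variational theta_init iterates k w)
    a0 a_dvg lambda0 lambdaE _ _ q0).
    move=> j; have := (g2 j).1.
    rewrite (_ : (fun k => _) = (fun k => a k *
      (G_is F ell (mu k w) (theta k w) (Y k.+1 w) j 0 -
       gradient (objective P F) (theta k w) j 0)))//.
    by apply/funext => k; rewrite !dotv_delta.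
  move=> j; apply/cvgrPdist_lt => e e0.
  (* [c2] has no prescribed sign, hence the divisor [|c2| + 1]. *)
  have c20 : 0 < `|c2| + 1 by rewrite ltr_wpDl.
  have small : \forall k \near \oo, enorm (theta k w - thetastar) < e / (`|c2| + 1).
    by apply: (cvgr_lt _ (enorm_cvg q0)); rewrite divr_gt0.
  apply: filterS small => k; rewrite ltr_pdivlMr// => ke.
  apply: le_lt_trans ke; apply: (le_trans (entry_dist_le_enorm _ _ _)).
  apply: (le_trans (gradf_lip _ (th_in k w))).
  by rewrite mulrC ler_wpM2l ?enorm_ge0// (le_trans (ler_norm _))// lerDl.
have Bm0 : 0 <= Bm by apply: le_trans (mB _ Mms); exact: dotvv_ge0.
pose E := Num.sqrt Bm.
pose qm k := dotv (mu k w - mustar) (mu k w - mustar).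
have [_ q0'] : cvgn (series (fun k => a k * qm k)) /\ qm k @[k --> \oo] --> 0.
  (* The drift holds once the face is reached, from [N] on. In the error, [c3 * qt k] bounds the
     change of gradient and [E] the distance to [mustar]; [sum_q] makes it summable. *)
  apply: (dual_averaging_cvg Mms (mu_in ^~ w)
    (fun k => mu_variational mu_init iterates k w) a0 a_dvg c1_gt0 hn
    (sqE _ _ (fun i => (h2 i).2)) (N := N) (e := fun k => c3 * E * qt k)) => [k Nk|].
    have Tk := th_in k w; have Mk := mu_in k w; have fk := faceN k Nk.
    have vd := v_diff _ _ Tk fk Mk.
    have vds := v_diff _ _ Tts (active_face_self A b thetastar) Mk.
    have Hm := H_mean_le G_meas ell_meas gradell_meas ell_convex ell_diff
      G_bound H_bound Tk Mk Mms vd.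
    have vc := convex_on_gradient
      (v_is_convex G_meas ell_meas ell_convex G_bound Tts) Mk Mms vds.
    (* [H_mean_le] points from [mu k w] to [mustar], the energy the other way. *)
    have HuE : \int[P]_x dotv (H_is A b F ell (theta k w) (mu k w) x) (mu k w - mustar) =
       -1 * \int[P]_x dotv (H_is A b F ell (theta k w) (mu k w) x) (mustar - mu k w).
      have iH := integrable_Hu G_meas gradell_meas H_bound Tk Mk (mustar - mu k w).
      rewrite -(RintegralZl (-1) measurableT iH).
      by apply: eq_Rintegral => x _; rewrite -(opprB (mu k w)) dotvNr mulN1r opprK.
    have gt := gradv_theta _ _ Tk fk Mk; rewrite enorm_sqr -/(qt k) in gt.
    have eE : enorm (mu k w - mustar) <= E by exact: ler_wsqrtr (mB _ Mk).
    rewrite HuE [c3 * E * _]mulrAC.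
    exact: perturbed_drift Hm vc (v_growth _ Mk) gt eE.
  rewrite (_ : (fun k => _) = (fun k => c3 * E * (a k * qt k))).
    exact: cvgn_seriesZ.
  by apply/funext => k; rewrite mulrCA.
have muc := vec_cvg q0'.
exact: (cvg_pair thc muc).
Qed.
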